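(* Every countably categorical linear order $L$ has a canonical tree presentation, i.e. there is a tree presentation $T$ such that $L$ is isomorphic to $\mathcal{L}_T$ and every automorphism of the linear order $\mathcal{L}_T$ is an automorphism of $\mathcal{L}^*_T$ (so $\mathrm{Aut}(\mathcal{L}_T)=\mathrm{Aut}(\mathcal{L}^*_T)$).
   Context: A countably categorical linear order is a countable (possibly finite) linear order $L$ such that every countable linear order satisfying the same first-order theory as $L$ (in the language of linear orders) is isomorphic to $L$. Tree presentations are finite trees whose nodes are finite sequences of positive integers, each node labelled $\ell$ (leaf), $s$ (sum) or $\sigma$ (shuffle), defined inductively: $1$ is the tree consisting only of the root $\langle\rangle$, labelled $\ell$; if $T_1,\dots,T_k$ ($k\ge1$) are tree presentations then $s(T_1,\dots,T_k)$ (resp. $\sigma(T_1,\dots,T_k)$) is the tree whose nodes are the root $\langle\rangle$, labelled $s$ (resp. $\sigma$), together with the nodes $\langle i\rangle^\frown t$ for $1\le i\le k$ and $t\in T_i$, labelled as $t$ is in $T_i$. For a sequence $u$ and $i\le|u|$, $u\upharpoonright i$ is its initial segment of length $i$. Fix once and for all a partition $\langle\mathbb{Q}_n\rangle_{n\ge1}$ of $\mathbb{Q}$ into sets each dense in $\mathbb{Q}$, with $n\in\mathbb{Q}_n$. For $q\in\mathbb{Q}$ let $\#(q)$ be the $n$ with $q\in\mathbb{Q}_n$; for $\bar r=\langle r_0,\dots,r_{m-1}\rangle$ let $\#(\bar r)=\langle\#(r_0),\dots,\#(r_{m-1})\rangle$. $\mathcal{L}_T$ is the set of finite sequences $\bar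 r$ of rationals such that $\#(\bar r)$ is a leaf of $T$ and for each $i<|\bar r|$, if $\#(\bar r)\upharpoonright i$ is a sum node then $r_i=\#(r_i)$, ordered lexicographically. For a node $t$, $D_t$ is the set of $\bar r\in\mathcal{L}_T$ such that $\#(\bar r)$ extends $t$. $\mathcal{L}^*_T$ is the expansion of $(\mathcal{L}_T,<)$ by binary relations $E_t$ ($t\in T$), where $\bar r\,E_t\,\bar s$ iff $\bar r,\bar s\in D_t$ and $\bar r\upharpoonright|t|=\bar s\upharpoonright|t|$. A tree presentation $T$ is called canonical if every automorphism of $(\mathcal{L}_T,<)$ is also an automorphism of $\mathcal{L}^*_T$. *)

(* Defs.v *)
From HB Require Import structures.
From mathcomp Require Import all_boot all_order all_algebra.
From mathcomp Require Import classical_sets cardinality.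

Set Implicit Arguments.
Unset Strict Implicit.
Unset Printing Implicit Defensive.

Import Order.TTheory GRing.Theory Num.Theory.

Local Open Scope order_scope.

(* [formula n] has its free variables among the de Bruijn indices ['I_n]; being
   well scoped, sentences ([formula 0]) are evaluated without any valuation. *)
Inductive formula : nat -> Type :=
| FEq n of 'I_n & 'I_n : formula n
| FLt n of 'I_n & 'I_n : formula n
| FNot n of formula n : formula n
| FAnd n of formula n & formula n : formula n
| FExists n of formula n.+1 : formula n.

Fixpoint sat (d : Order.disp_t) (L : orderType d) (n : nat) (phi : formula n)
    : n.-tuple L -> Prop :=
  match phi with
  | FEq _ i j => fun e => tnth e i = tnth e j
  | FLt _ i j => fun e => tnth e i < tnth e j
  | FNot _ p => fun e => ~ sat p e
  | FAnd _ p q => fun e => sat p e /\ sat q e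
  | FExists _ p => fun e => exists x : L, sat p [tuple of x :: e]
  end.

Definition models (d : Order.disp_t) (L : orderType d) (phi : formula 0) : Prop :=
  sat phi ([tuple] : 0.-tuple L).

Definition same_theory (d d' : Order.disp_t) (L : orderType d) (M : orderType d')
    : Prop :=
  forall phi : formula 0, models L phi <-> models M phi.

Definition order_iso (d d' : Order.disp_t) (L : orderType d) (M : orderType d')
    (f : L -> M) : Prop :=
  bijective f /\ {mono f : x y / x < y}.

Definition isomorphic (d d' : Order.disp_t) (L : orderType d) (M : orderType d')
    : Prop :=
  exists f : L -> M, order_iso f.

(* [countable] includes the finite case. *)
Definition countably_categorical (d : Order.disp_t) (L : orderType d) : Prop :=
  countable [set: L] /\
  forall (d' : Order.disp_t) (M : orderType d'),
    countable [set: M] -> same_theory L M -> isomorphic M L.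

(* Head and tail are passed separately: sum and shuffle nodes have at least one
   child. *)
Inductive tree : Type :=
| TLeaf
| TSum of tree & seq tree
| TShuffle of tree & seq tree.

Variant label : Type := LLeaf | LSum | LShuffle.

Definition root_label (T : tree) : label :=
  match T with
  | TLeaf => LLeaf
  | TSum _ _ => LSum
  | TShuffle _ _ => LShuffle
  end.

Definition children (T : tree) : seq tree :=
  match T with
  | TLeaf => [::]
  | TSum T1 Ts | TShuffle T1 Ts => T1 :: Ts
  end.

(* The label of the node [u] of [T], [None] if [u] is not a node; children are
   numbered from 1. *)
Fixpoint node_label (T : tree) (u : seq nat) : option label :=
  match u with
  | [::] => Some (root_label T)
  | 0 :: _ => None
  | i.+1 :: v => if onth (children T) i is Some Ti then node_label Ti v else None
  end.

Definition is_node (T : tree) (u : seq nat) : bool := isSome (node_label T u).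

Definition is_leaf (T : tree) (u : seq nat) : bool :=
  if node_label T u is Some LLeaf then true else false.

Definition is_sum (T : tree) (u : seq nat) : bool :=
  if node_label T u is Some LSum then true else false.

(* A partition (Q_n)_{n >= 1} of the rationals is given by its class function
   [num], so that Q_n is [num @^-1` [set n]]. *)
Definition dense_partition (num : rat -> nat) : Prop :=
  [/\ forall q : rat, (0 < num q)%N,
      forall n : nat, (0 < n)%N -> num n%:R%R = n
    & forall n : nat, (0 < n)%N -> forall a b : rat, a < b ->
        exists q : rat, [/\ num q = n, a < q & q < b]].

Definition in_order (num : rat -> nat) (T : tree) (r : seqlexi rat) : bool :=
  is_leaf T (map num r) &&
  [forall i : 'I_(size r),
     is_sum T (take i (map num r)) ==> (nth 0%R r i == (num (nth 0%R r i))%:R%R)].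

Record tree_order (num : rat -> nat) (T : tree) : Type := TreeOrder {
  tree_order_val : seqlexi rat;
  _ : in_order num T tree_order_val }.

HB.instance Definition _ (num : rat -> nat) (T : tree) :=
  [isSub for @tree_order_val num T].
HB.instance Definition _ (num : rat -> nat) (T : tree) :=
  [Choice of tree_order num T by <:].

Fact tree_order_display : Order.disp_t. Proof. exact: Order.Disp tt tt. Qed.

HB.instance Definition _ (num : rat -> nat) (T : tree) :=
  [SubChoice_isSubOrder of tree_order num T by <: with tree_order_display].

Definition in_D (num : rat -> nat) (T : tree) (t : seq nat)
    (r : tree_order num T) : bool :=
  prefix t (map num (tree_order_val r)).

Definition rel_E (num : rat -> nat) (T : tree) (t : seq nat)
    (r s : tree_order num T) : bool :=
  [&& in_D t r, in_D t s &
      take (size t) (tree_order_val r) == take (size t) (tree_order_val s)].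

Definition order_automorphism (num : rat -> nat) (T : tree)
    (f : tree_order num T -> tree_order num T) : Prop :=
  order_iso f.

Definition star_automorphism (num : rat -> nat) (T : tree)
    (f : tree_order num T -> tree_order num T) : Prop :=
  order_iso f /\
  forall t : seq nat, is_node T t -> {mono f : r s / rel_E t r s}.

Definition canonical (num : rat -> nat) (T : tree) : Prop :=
  forall f : tree_order num T -> tree_order num T,
    order_automorphism f -> star_automorphism f.

(* Main.v *)
From HB Require Import structures.
From mathcomp Require Import all_boot all_order all_algebra.
From mathcomp Require Import boolp classical_sets cardinality.
Require Import Defs.

Set Implicit Arguments.
Unset Strict Implicit.
Unset Printing Implicit Defensive.

Import Order.TTheory GRing.Theory Num.Theory.

Local Open Scope order_scope.

(* A generic construction of countable models (which first omits a non-isolated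
   type, then realises an accumulation point of isolated ones) gives the
   Ryll-Nardzewski theorem: the automorphism group of [L] has finitely many
   orbits on pairs. Colour the points of [L] by the one-point tree and iterate
   the following condensation: identify two points that have finitely many
   points between them, or that lie in a common open interval in which every
   occurring colour is dense. Its classes are finite sequences or maximal
   shuffles, and are coloured by the sum, resp. the shuffle, of the colours they
   contain. Each nontrivial step lowers the number of orbits on pairs, and a step
   is trivial only on a one-point order, whose colour is then the required tree.
   The condensation is defined from the coloured order alone, so automorphisms
   respect it at every stage: this is canonicity. *)

(** Orbits on pairs are counted because the number of orbits on points need not drop: a one-coloured
    copy of the rationals has one, and so has its one-point condensation. If [x <> y] are condensed,
    no pair of representatives lies in the orbit of [(x, y)], since the two would be condensed and
    hence equal. The two identifications combine into one equivalence because a shuffled interval is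
    dense, so a point inside it is at finite distance from itself alone. Finite-distance classes are
    finite because an automorphism fixing a point fixes all points at finite distance from it. Every
    class, singletons included, adds one level to the tree, so all leaves have the same depth: the
    first condensation supplies the last coordinate, and the final one-point order carries the
    root. *)

(** * Generic sequences and back-and-forth *)

(** The Rasiowa-Sikorski argument: the requirements are countably many, so stage [s.+1] can meet the
    one coded by [s]. *)
Lemma generic_sequence (C : Type) (good : C -> Prop) (ext : C -> C -> Prop)
    (R : countType) (D : R -> C -> Prop) (c0 : C) :
  good c0 -> (forall c, ext c c) ->
  (forall c1 c2 c3, ext c1 c2 -> ext c2 c3 -> ext c1 c3) ->
  (forall r c, good c -> exists c', [/\ good c', ext c c' & D r c']) ->
  exists cs : nat -> C,
    [/\ cs 0 = c0, forall s, good (cs s),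
        forall s t, (s <= t)%N -> ext (cs s) (cs t)
      & forall r, exists s, D r (cs s)].
Proof.
move=> good0 ext_refl ext_trans dense.
have /choice [next nextP] : forall cr : C * R, exists c',
    good cr.1 -> [/\ good c', ext cr.1 c' & D cr.2 c'].
  move=> [c r]; have [gc|ngc] := pselect (good c); last by exists c.
  by have [c' c'P] := dense r c gc; exists c'.
pose step s c := if unpickle s is Some r then next (c, r) else c.
pose cs := fix cs s := if s is s'.+1 then step s' (cs s') else c0.
have gcs s : good (cs s).
  elim: s => //= s IHs; rewrite /step; case: unpickle => // r.
  by have [] := nextP (cs s, r) IHs.
exists cs; split => //.
- move=> s t /subnK <-; elim: (t - s)%N => [|m IHm]; first exact: ext_refl.
  apply: ext_trans IHm _; rewrite addSn /= /step; case: unpickle => // r.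
  by have [] := nextP (cs (m + s)%N, r) (gcs _).
- move=> r; exists (pickle r).+1; rewrite /= /step pickleK.
  by have [] := nextP (cs (pickle r), r) (gcs _).
Qed.

Lemma countable_injection (T : Type) :
  countable [set: T] -> exists f : T -> nat, injective f.
Proof.
by move=> /countable_injP [f f_inj]; exists f => x y; apply: f_inj; rewrite inE.
Qed.

(** The predicates [A] and [B] let a single class of a condensation be treated without making it a
    type; outside [A] the map is arbitrary. The invariant [P] is whatever keeps a finite partial map
    extendible. *)
Lemma back_and_forth (d d' : Order.disp_t) (X : orderType d) (Y : orderType d')
    (A : X -> Prop) (B : Y -> Prop) (P : seq (X * Y) -> Prop)
    (s0 : seq (X * Y)) :
  countable [set: X] -> countable [set: Y] -> inhabited Y -> P s0 ->
  (forall s p, P s -> p \in s -> A p.1 /\ B p.2) ->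
  (forall s p q, P s -> p \in s -> q \in s -> (p.1 < q.1) = (p.2 < q.2)) ->
  (forall s x, P s -> A x -> exists y, P ((x, y) :: s)) ->
  (forall s y, P s -> B y -> exists x, P ((x, y) :: s)) ->
  exists f : X -> Y,
    [/\ forall x, A x -> B (f x),
        forall x y, A x -> A y -> (f x < f y) = (x < y),
        forall y, B y -> exists2 x, A x & f x = y,
        forall x, A x -> exists2 s, P s & (x, f x) \in s
      & forall p, p \in s0 -> f p.1 = p.2].
Proof.
move=> /countable_injection[fX fX_inj] /countable_injection[fY fY_inj] [y0].
move=> P0 PAB Pmono forth back.
pose D (r : nat + nat) (s : seq (X * Y)) := match r with
  | inl n => forall x, A x -> fX x = n -> exists y, (x, y) \in s
  | inr n => forall y, B y -> fY y = n -> exists x, (x, y) \in s end.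
have dense r s : P s -> exists s', [/\ P s', {subset s <= s'} & D r s'].
  move=> Ps; case: r => n /=.
  - have [[x [Ax xn]]|nx] := pselect (exists x, A x /\ fX x = n); last first.
      by exists s; split=> // x Ax xn; case: nx; exists x.
    have [y Py] := forth s x Ps Ax; exists ((x, y) :: s); split => //.
      by move=> p ps; rewrite inE ps orbT.
    move=> x' _ x'n; exists y; rewrite inE -[x'](fX_inj x) ?eqxx //.
    by rewrite xn x'n.
  - have [[y [By yn]]|ny] := pselect (exists y, B y /\ fY y = n); last first.
      by exists s; split=> // y By yn; case: ny; exists y.
    have [x Px] := back s y Ps By; exists ((x, y) :: s); split => //.
      by move=> p ps; rewrite inE ps orbT.
    move=> y' _ y'n; exists x; rewrite inE -[y'](fY_inj y) ?eqxx //.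
    by rewrite yn y'n.
have [||ss [ss0 Pss ext_ss Dss]] := generic_sequence P0 _ _ dense.
- by move=> c p.
- by move=> c1 c2 c3 c12 c23 p /c12/c23.
have common p q s t : p \in ss s -> q \in ss t ->
    exists2 u, P u & p \in u /\ q \in u.
  move=> ps qt; exists (ss (maxn s t)) => //; split.
    by apply: (ext_ss s) => //; rewrite leq_maxl.
  by apply: (ext_ss t) => //; rewrite leq_maxr.
have funss p q s t : p \in ss s -> q \in ss t -> (p.1 = q.1) <-> (p.2 = q.2).
  move=> ps qt; have [u Pu [pu qu]] := common _ _ _ _ ps qt.
  have pq := Pmono u p q Pu pu qu; have qp := Pmono u q p Pu qu pu.
  by split=> eq_pq; apply/eqP; rewrite eq_le !leNgt;
    [rewrite -qp -pq|rewrite qp pq]; rewrite eq_pq ltxx.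
have /choice [f fP] : forall x, exists y, A x -> exists s, (x, y) \in ss s.
  move=> x; have [Ax|nAx] := pselect (A x); last by exists y0.
  have [s] := Dss (inl (fX x)); case/(_ x Ax erefl) => y ys.
  by exists y => _; exists s.
exists f; split.
- by move=> x Ax; have [s /(PAB _ _ (Pss s))[]] := fP x Ax.
- move=> x y Ax Ay; have [s xs] := fP x Ax; have [t yt] := fP y Ay.
  by have [u Pu [xu yu]] := common _ _ _ _ xs yt; rewrite (Pmono u _ _ Pu xu yu).
- move=> y By; have [s] := Dss (inr (fY y)); case/(_ y By erefl) => x xs.
  have [Ax _] := PAB _ _ (Pss s) xs; exists x => //.
  by have [t xt] := fP x Ax; have /funss/(_ xs)[/(_ erefl)] := xt.
- by move=> x Ax; have [s xs] := fP x Ax; exists (ss s).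
- move=> p ps; rewrite -ss0 in ps; have [Ap _] := PAB _ _ (Pss 0) ps.
  by have [t xt] := fP _ Ap; have /funss/(_ ps)[/(_ erefl)] := xt.
Qed.

(** * Ehrenfeucht-Fraisse types *)

Fixpoint eftype (k n : nat) : finType :=
  if k is k'.+1 then {set eftype k' n.+1} else {ffun 'I_n * 'I_n -> bool}.

(* [ef k n e] is the type of the first [n] entries of [e] for the game of
   length [k]; entries beyond the size of [e] are read as [x0]. Types of tuples
   in different orders live in the same finite type, hence can be compared. *)
Fixpoint ef (d : Order.disp_t) (L : orderType d) (x0 : L) (k : nat) :
    forall n, seq L -> eftype k n :=
  match k return forall n, seq L -> eftype k n with
  | 0 => fun n e => [ffun p : 'I_n * 'I_n => nth x0 e p.1 < nth x0 e p.2]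
  | k'.+1 => fun n e =>
      [set t : eftype k' n.+1 | `[< exists x, ef x0 k' n.+1 (x :: e) = t >]]
  end.

Section EFTypes.
Variables (d d' : Order.disp_t) (L : orderType d) (M : orderType d').
Variables (x0 : L) (y0 : M).

Lemma ef0P n e e' :
  ef x0 0 n e = ef y0 0 n e' <->
  (forall i j, (i < n)%N -> (j < n)%N ->
     (nth x0 e i < nth x0 e j) = (nth y0 e' i < nth y0 e' j)).
Proof.
split=> [/ffunP eq_e i j lin ljn|eq_e]; last by apply/ffunP=> p; rewrite !ffunE eq_e.
by have := eq_e (Ordinal lin, Ordinal ljn); rewrite !ffunE.
Qed.

Lemma efSP k n e e' :
  ef x0 k.+1 n e = ef y0 k.+1 n e' <->
  (forall x, exists y, ef x0 k n.+1 (x :: e) = ef y0 k n.+1 (y :: e')) /\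
  (forall y, exists x, ef x0 k n.+1 (x :: e) = ef y0 k n.+1 (y :: e')).
Proof.
split=> [eq_e|[forth back]].
  split=> z.
    have : ef x0 k n.+1 (z :: e) \in ef x0 k.+1 n e.
      by rewrite inE; apply/asboolP; exists z.
    by rewrite eq_e inE => /asboolP[y eq_y]; exists y.
  have : ef y0 k n.+1 (z :: e') \in ef y0 k.+1 n e'.
    by rewrite inE; apply/asboolP; exists z.
  by rewrite -eq_e inE => /asboolP[x eq_x]; exists x.
apply/setP=> t; rewrite !inE; apply/asboolP/asboolP => -[z <-].
  by have [y eq_y] := forth z; exists y.
by have [x eq_x] := back z; exists x.
Qed.

End EFTypes.

Section EFLemmas.
Variables (d d' : Order.disp_t) (L : orderType d) (M : orderType d').
Variables (x0 : L) (y0 : M).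

Lemma ef_ext x1 k n (e e' : seq L) :
  (forall i, (i < n)%N -> nth x0 e i = nth x1 e' i) -> ef x0 k n e = ef x1 k n e'.
Proof.
elim: k n e e' => [|k IHk] n e e' eq_e.
  by apply/ef0P => i j lin ljn; rewrite !eq_e.
apply/efSP; split=> x; exists x; apply: IHk => -[|i] //=; exact: eq_e.
Qed.

(** A strategy does not depend on how positions are listed, so entries may be permuted, repeated or
    dropped. New entries come at the head, hence the shift by [S] in the induction. *)
Lemma ef_reindex k n m (i : seq nat) e e' :
  (m <= size i)%N -> all (fun j => j < n)%N i -> ef x0 k n e = ef y0 k n e' ->
  ef x0 k m (map (nth x0 e) i) = ef y0 k m (map (nth y0 e') i).
Proof.
elim: k n m i e e' => [|k IHk] n m i e e' szi lti.
  move=> /ef0P eq_e; apply/ef0P => j l ltj ltl.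
  have ltn j' : (j' < m)%N -> (nth 0 i j' < n)%N.
    by move=> ?; apply: (allP lti); rewrite mem_nth // (leq_trans _ szi).
  rewrite !(nth_map 0) ?(leq_trans _ szi) //; apply: eq_e; exact: ltn.
have up (K : Type) (z0 z : K) (u : seq K) :
    z :: map (nth z0 u) i = map (nth z0 (z :: u)) (0 :: map S i).
  by rewrite /= -map_comp.
move=> /efSP[forth back]; apply/efSP; split=> [x|y].
  have [y eq_xy] := forth x; exists y; rewrite !up.
  apply: (IHk n.+1) eq_xy; rewrite /= ?size_map //.
  by rewrite all_map.
have [x eq_xy] := back y; exists x; rewrite !up.
apply: (IHk n.+1) eq_xy; rewrite /= ?size_map //.
by rewrite all_map.
Qed.

Lemma ef_take k n m e e' : (m <= n)%N ->
  ef x0 k n e = ef y0 k n e' -> ef x0 k m e = ef y0 k m e'.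
Proof.
elim: k n m e e' => [|k IHk] n m e e' lemn.
  move=> /ef0P eq_e; apply/ef0P => i j lti ltj.
  by apply: eq_e; rewrite (leq_trans _ lemn).
move=> /efSP[forth back]; apply/efSP; split=> z.
  by have [y eq_y] := forth z; exists y; apply: IHk eq_y.
by have [x eq_x] := back z; exists x; apply: IHk eq_x.
Qed.

Lemma ef_pred k n e e' :
  ef x0 k.+1 n e = ef y0 k.+1 n e' -> ef x0 k n e = ef y0 k n e'.
Proof.
elim: k n e e' => [|k IHk] n e e' /efSP[forth back].
  have [y /ef0P eq_xy] := forth x0; apply/ef0P => i j lti ltj.
  exact: (eq_xy i.+1 j.+1).
apply/efSP; split=> z.
  by have [y eq_y] := forth z; exists y; apply: IHk eq_y.
by have [x eq_x] := back z; exists x; apply: IHk eq_x.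
Qed.

Lemma ef_le k l n e e' : (l <= k)%N ->
  ef x0 k n e = ef y0 k n e' -> ef x0 l n e = ef y0 l n e'.
Proof.
move=> /subnK <-; elim: (k - l)%N => // m IHm; rewrite addSn => /ef_pred.
exact: IHm.
Qed.

(** Replying to the entries of [p] costs [m] rounds and leaves [k]; this transplants a whole finite
    configuration over another tuple. *)
Lemma ef_catl k m n p e e' :
  size p = m -> ef x0 (m + k) n e = ef y0 (m + k) n e' ->
  exists2 q, size q = m & ef x0 k (m + n) (p ++ e) = ef y0 k (m + n) (q ++ e').
Proof.
elim: p m k => [|x p IHp] m k <-; first by exists [::].
rewrite [size _]/= addSnnS => eq_e.
have [q szq /efSP[/(_ x)[y eq_xy] _]] := IHp (size p) k.+1 erefl eq_e.
by exists (y :: q) => //=; rewrite szq.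
Qed.

End EFLemmas.

Lemma ef_iso (d d' : Order.disp_t) (L : orderType d) (M : orderType d')
    (f : L -> M) (x0 : L) k n e : order_iso f ->
  ef (f x0) k n (map f e) = ef x0 k n e.
Proof.
move=> [[g fK gK] f_mono]; elim: k n e => [|k IHk] n e.
  have nthf i : nth (f x0) (map f e) i = f (nth x0 e i).
    have [ltie|leei] := ltnP i (size e); first exact: nth_map.
    by rewrite !nth_default ?size_map.
  by apply/ef0P => i j _ _; rewrite !nthf f_mono.
apply/efSP; split=> z; last by exists (f z); exact: (IHk _ (z :: e)).
by exists (g z); rewrite -(IHk _ (g z :: e)) /= gK.
Qed.

Fixpoint quantifier_depth n (phi : formula n) : nat :=
  match phi with
  | FEq _ _ _ | FLt _ _ _ => 0
  | FNot _ p => quantifier_depth p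
  | FAnd _ p q => maxn (quantifier_depth p) (quantifier_depth q)
  | FExists _ p => (quantifier_depth p).+1
  end.

Lemma ef_sat (d d' : Order.disp_t) (L : orderType d) (M : orderType d')
    (x0 : L) (y0 : M) n (phi : formula n) k (e : n.-tuple L) (e' : n.-tuple M) :
  (quantifier_depth phi <= k)%N -> ef x0 k n e = ef y0 k n e' ->
  sat phi e <-> sat phi e'.
Proof.
elim: phi k e e' => {n} [n i j|n i j|n p IHp|n p IHp q IHq|n p IHp] k e e' /=.
- move=> _ /(ef_le (leq0n k))/ef0P eq_e; rewrite !(tnth_nth x0) !(tnth_nth y0).
  (* Types record only strict comparisons; equality is the failure of both. *)
  have ij := eq_e i j (ltn_ord i) (ltn_ord j).
  have ji := eq_e j i (ltn_ord j) (ltn_ord i).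
  by split=> E; apply/eqP; rewrite eq_le !leNgt;
    [rewrite -ij -ji|rewrite ij ji]; rewrite E ltxx.
- move=> _ /(ef_le (leq0n k))/ef0P eq_e; rewrite !(tnth_nth x0) !(tnth_nth y0).
  by rewrite eq_e.
- by move=> lek /(IHp _ _ _ lek) [pe qe]; split=> np ?; apply: np; auto.
- rewrite geq_max => /andP[lep leq] eq_e.
  by have [] := IHp _ _ _ lep eq_e; have [] := IHq _ _ _ leq eq_e; tauto.
- case: k => // k lek /efSP[forth back]; split=> -[z pz].
    have [y eq_y] := forth z; exists y.
    by apply/(IHp k [tuple of z :: e] [tuple of y :: e']).
  have [x eq_x] := back z; exists x.
  by apply/(IHp k [tuple of x :: e] [tuple of z :: e']).
Qed.

Lemma ef_same_theory (d d' : Order.disp_t) (L : orderType d) (M : orderType d')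
    (x0 : L) (y0 : M) :
  (forall k, ef x0 k 0 [::] = ef y0 k 0 [::]) -> same_theory L M.
Proof.
by move=> eqk phi; apply: (ef_sat (leqnn (quantifier_depth phi))); apply: eqk.
Qed.

(** * Limits of finite approximations *)

(** A limit is built on indices, and different indices may name the same point: hence a preorder,
    whose quotient is then formed by least representatives to stay countable. *)
Record nat_preorder := NatPreorder {
  preorder_le : rel nat;
  preorder_le_trans : transitive preorder_le;
  preorder_le_total : total preorder_le }.

Definition first_of_class (p : nat_preorder) (i : nat) : bool :=
  [forall j : 'I_i, ~~ (preorder_le p i j && preorder_le p j i)].

Record preorder_quotient (p : nat_preorder) := PreorderQuotient {
  quotient_val : nat;
  _ : first_of_class p quotient_val }.

HB.instance Definition _ p := [isSub for @quotient_val p].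
HB.instance Definition _ p := [Countable of preorder_quotient p by <:].

Fact quotient_display : Order.disp_t. Proof. exact: Order.Disp tt tt. Qed.

Section QuotientOrder.
Variable p : nat_preorder.

Definition quotient_le (x y : preorder_quotient p) := preorder_le p (val x) (val y).

Lemma quotient_le_anti : antisymmetric quotient_le.
Proof.
rewrite /quotient_le => x y /andP[lexy leyx]; apply: val_inj; apply/eqP.
case: ltngtP => // [ltxy|ltyx].
  by have /forallP/(_ (Ordinal ltxy)) := valP y; rewrite /= leyx lexy.
by have /forallP/(_ (Ordinal ltyx)) := valP x; rewrite /= lexy leyx.
Qed.

Lemma quotient_le_trans : transitive quotient_le.
Proof. by move=> x y z; apply: preorder_le_trans. Qed.

Lemma quotient_le_total : total quotient_le.
Proof. by move=> x y; apply: preorder_le_total. Qed.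

End QuotientOrder.

HB.instance Definition _ p :=
  Order.isOrder.Build quotient_display (preorder_quotient p)
    (fun _ _ => erefl) (fun _ _ => erefl) (fun _ _ => erefl)
    (@quotient_le_anti p) (@quotient_le_trans p) (@quotient_le_total p).

Lemma quotient_map (p : nat_preorder) :
  exists c : nat -> preorder_quotient p,
    (forall x, exists i, c i = x) /\
    (forall i j, (c i <= c j) = preorder_le p i j).
Proof.
have rep i : exists x : preorder_quotient p,
    preorder_le p i (val x) && preorder_le p (val x) i.
  have ex : exists j, preorder_le p i j && preorder_le p j i.
    by exists i; have := preorder_le_total p i i; rewrite orbb => ->.
  case: (ex_minnP ex) => j /andP[ij ji] minj.
  have fj : first_of_class p j.
    apply/forallP => l; apply/negP => /andP[jl lj].
    have := minj l; rewrite leqNgt ltn_ord => ngt; apply: notF; apply: ngt.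
    by rewrite (preorder_le_trans ij jl) (preorder_le_trans lj ji).
  by exists (PreorderQuotient fj); rewrite /= ij ji.
have [c cP] := choice rep; exists c; split.
  move=> x; exists (val x); apply: le_anti.
  by have /andP[xc cx] := cP (val x); rewrite /Order.le /= /quotient_le cx xc.
move=> i j; have /andP[ic ci] := cP i; have /andP[jc cj] := cP j.
rewrite /Order.le /= /quotient_le; apply/idP/idP => [le_c|le_ij].
  exact: preorder_le_trans (preorder_le_trans ic le_c) cj.
exact: preorder_le_trans (preorder_le_trans ci le_ij) jc.
Qed.

Section Limit.
Variables (d : Order.disp_t) (L : orderType d) (x0 : L).

(* The condition [(a, k)] promises that the first [size a] elements of the limit
   have the same type as [a] for the game of length [k]. *)
Definition condition := (seq L * nat)%type.

Definition extends (c c' : condition) : Prop :=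
  [/\ (size c.1 <= size c'.1)%N, (c.2 <= c'.2)%N
    & ef x0 c.2 (size c.1) c.1 = ef x0 c.2 (size c.1) c'.1].

Definition select (a : seq L) (i : seq nat) : seq L := map (nth x0 a) i.

Definition in_range (i : seq nat) (c : condition) : bool :=
  all (fun j => j < size c.1)%N i.

(** Henkin requirement: a one-point extension that the promise grants to the tuple [i] is realised
    by an index already present. The type is given by its code [p] because it lives in a type
    depending on [i] and [k]. *)
Definition witnessed (r : seq nat * nat * nat) (c : condition) : Prop :=
  let: (i, k, p) := r in
  [/\ in_range i c, (k < c.2)%N
    & forall t : eftype k (size i).+1, pickle t = p ->
        t \in (ef x0 k.+1 (size i) (select c.1 i) : {set _}) ->
        exists2 m, (m < size c.1)%N
          & ef x0 k (size i).+1 (nth x0 c.1 m :: select c.1 i) = t].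

Lemma extends_refl c : extends c c. Proof. by []. Qed.

Lemma extends_trans c1 c2 c3 : extends c1 c2 -> extends c2 c3 -> extends c1 c3.
Proof.
move=> [sz12 k12 ef12] [sz23 k23 ef23]; split.
- exact: leq_trans sz12 sz23.
- exact: leq_trans k12 k23.
- by rewrite ef12; apply: ef_le k12 _; apply: ef_take sz12 _.
Qed.

Lemma in_range_extends i c c' : extends c c' -> in_range i c -> in_range i c'.
Proof. by move=> [szc _ _]; apply: sub_all => j /leq_trans; apply. Qed.

Lemma extends_select c c' i k : extends c c' -> in_range i c -> (k <= c.2)%N ->
  ef x0 k (size i) (select c.1 i) = ef x0 k (size i) (select c'.1 i).
Proof. by move=> [_ _ eqc] ri lek; apply: ef_reindex ri (ef_le lek eqc). Qed.

(** By induction on the depth: a point of the limit is an index and is answered through the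
    promises, while a point of [L] is answered by a witnessing index. *)
Lemma limit_order (cs : nat -> condition) :
  (forall s t, (s <= t)%N -> extends (cs s) (cs t)) ->
  (forall r, exists s, witnessed r (cs s)) ->
  exists (p : nat_preorder) (c : nat -> preorder_quotient p),
    (forall x, exists i, c i = x) /\
    (forall s k i, in_range i (cs s) -> (k <= (cs s).2)%N ->
       ef (c 0) k (size i) (map c i) = ef x0 k (size i) (select (cs s).1 i)).
Proof.
move=> ext_cs wit_cs.
have range i : exists s, in_range i (cs s).
  by have [s [ri _ _]] := wit_cs (i, 0, 0); exists s.
have eq_select s t i k : in_range i (cs s) -> in_range i (cs t) ->
    (k <= (cs s).2)%N -> (k <= (cs t).2)%N ->
    ef x0 k (size i) (select (cs s).1 i) = ef x0 k (size i) (select (cs t).1 i).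
  move=> ris rit leks lekt.
  rewrite (extends_select (ext_cs _ _ (leq_maxl s t))) //.
  by rewrite (extends_select (ext_cs _ _ (leq_maxr s t)) rit).
pose le i j := `[< exists2 s, in_range [:: i; j] (cs s)
                   & nth x0 (cs s).1 i <= nth x0 (cs s).1 j >].
have leE s i j : in_range [:: i; j] (cs s) ->
    le i j = (nth x0 (cs s).1 i <= nth x0 (cs s).1 j).
  move=> rs; apply/asboolP/idP => [[t rt]|]; last by exists s.
  have /ef0P/(_ 1 0 isT isT)/= := eq_select s t _ 0 rs rt (leq0n _) (leq0n _).
  by rewrite !leNgt => ->.
have le_trans : transitive le.
  move=> j i l; have [s /and4P[ri rj rl _]] := range [:: i; j; l].
  by rewrite !(leE s) /in_range /= ?ri ?rj ?rl //; apply: Order.POrderTheory.le_trans.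
have le_tot : total le.
  move=> i j; have [s /and3P[ri rj _]] := range [:: i; j].
  by rewrite !(leE s) /in_range /= ?ri ?rj //; apply: Order.TotalTheory.le_total.
pose p := NatPreorder le_trans le_tot.
have [c [c_surj cE]] := quotient_map p; exists p, c; split=> //.
move=> s k i; elim: k s i => [|k IHk] s i ris leks.
  apply/ef0P => u v ltu ltv.
  rewrite !(nth_map 0) // !ltNge cE [preorder_le _ _ _](leE s) //.
  by rewrite /in_range /= !(allP ris) // mem_nth.
apply/efSP; split=> [y|x].
  (* The index [m] may come into range only after stage [s], so the answer is found at a later stage
     and carried back along [extends]. *)
  have [m <-] := c_surj y; have [t rt] := range (m :: i).
  have rsel := in_range_extends (ext_cs _ _ (leq_maxr s t)) rt.
  have leku : (k <= (cs (maxn s t)).2)%N.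
    have [_ le2 _] := ext_cs _ _ (leq_maxl s t).
    by rewrite (leq_trans _ le2) // ltnW.
  have /efSP[_ /(_ (nth x0 (cs (maxn s t)).1 m))[x eq_x]] :=
    extends_select (ext_cs _ _ (leq_maxl s t)) ris leks.
  by exists x; rewrite eq_x; exact: (IHk _ (m :: i) rsel leku).
pose t := ef x0 k (size i).+1 (x :: select (cs s).1 i).
have [u [riu ltku /(_ t erefl)]] := wit_cs (i, k, pickle t).
case.
  rewrite -(eq_select s u _ k.+1) // inE; apply/asboolP; by exists x.
move=> m ltm eq_m; exists (c m); rewrite -/t -eq_m.
apply: (IHk u (m :: i)); last exact: ltnW.
by rewrite /in_range /= ltm.
Qed.

(** Two closure properties suffice for the Henkin requirements: the promise can be deepened, and one
    round of it can be spent on appending any point. The predicate [good] is trivial when a type is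
    omitted and restrictive when an accumulation point is realised. *)
Lemma witness_dense (good : condition -> Prop) :
  (forall a k, good (a, k) ->
     exists a', good (a', k.+1) /\ extends (a, k) (a', k.+1)) ->
  (forall a k b, good (a, k.+1) -> good (rcons a b, k)) ->
  (forall N c, good c ->
     exists c', [/\ good c', extends c c', (N <= size c'.1)%N & (N <= c'.2)%N]) /\
  (forall r c, good c -> exists c', [/\ good c', extends c c' & witnessed r c']).
Proof.
move=> raise append.
have append_ext a a' b k :
    extends (a, k) (a', k.+1) -> extends (a, k) (rcons a' b, k).
  move=> [/= sza _ eqa]; split=> //=; first by rewrite size_rcons leqW.
  rewrite eqa; apply: ef_ext => i lti.
  by rewrite nth_rcons (leq_trans lti sza).
have grow N c : good c ->
    exists c', [/\ good c', extends c c', (N <= size c'.1)%N & (N <= c'.2)%N].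
  elim: N c => [|N IHN] c gc; first by exists c.
  have [[a k] [ga ext_ca /= sza lek]] := IHN c gc.
  have [a1 [ga1 ext_a1]] := raise _ _ ga.
  have [a2 [ga2 ext_a2]] := raise _ _ ga1.
  (* Two deepenings, one of them spent on an arbitrary appended point, leave a gain in both size and
     depth. *)
  exists (rcons a2 x0, k.+1); split=> //=.
  - by apply: append.
  - exact: extends_trans (extends_trans ext_ca ext_a1) (append_ext _ _ _ _ ext_a2).
  - have [/= sz1 _ _] := ext_a1; have [/= sz2 _ _] := ext_a2.
    by rewrite size_rcons ltnS (leq_trans sza) // (leq_trans sz1).
split=> // -[[i k] p] c gc.
have [[a l] [ga ext_ca /= sza ltkl]] := grow (maxn (\max_(j <- i) j).+1 k.+1) c gc.
move: sza ltkl; rewrite !geq_max => /andP[sza _] /andP[_ ltkl].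
have ri : in_range i (a, l).
  by apply/allP => j ji; apply: leq_trans sza; rewrite ltnS leq_bigmax_seq.
have [a' [ga' ext_a']] := raise _ _ ga.
have ri' := in_range_extends ext_a' ri.
(* Either the type coded by [p] is realised, and its witness is appended at the cost of the round
   just gained, or the requirement holds vacuously. *)
have [[t tp /asboolP[b eq_b]]|nt] := pselect
    (exists2 t : eftype k (size i).+1, pickle t = p &
       `[< exists b, ef x0 k (size i).+1 (b :: select a' i) = t >]).
  exists (rcons a' b, l); split; first exact: append.
    exact: extends_trans ext_ca (append_ext _ _ _ _ ext_a').
  have sel : select (rcons a' b) i = select a' i.
    by apply/eq_in_map => j /(allP ri') /= ltj; rewrite nth_rcons ltj.
  split=> //=.
    by apply: sub_all ri' => j /= ltj; rewrite size_rcons ltnS ltnW.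
  move=> t' t'p _; exists (size a'); first by rewrite size_rcons.
  rewrite sel nth_rcons ltnn eqxx eq_b.
  by apply: (pcan_inj pickleK); rewrite tp t'p.
exists (a', l.+1); split=> //; first exact: extends_trans ext_ca ext_a'.
split=> //=; first by rewrite ltnS ltnW.
by move=> t tp; rewrite inE => tt; case: nt; exists t.
Qed.

End Limit.

(** * Isolated types and their finiteness *)

Section RyllNardzewski.
Variables (d : Order.disp_t) (L : orderType d) (x0 : L).

(** The notion of an isolated type, with a type of finite depth in place of an isolating formula. *)
Definition isolating (n k : nat) (e : seq L) : Prop :=
  forall e', ef x0 k n e = ef x0 k n e' -> forall j, ef x0 j n e = ef x0 j n e'.

Lemma isolating_ef n k e e' :
  ef x0 k n e = ef x0 k n e' -> isolating n k e -> isolating n k e'.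
Proof.
by move=> eq_e iso e'' eq_e' j; rewrite -(iso e') // -(iso e'') // eq_e.
Qed.

Lemma isolating_le n k l e : (k <= l)%N -> isolating n k e -> isolating n l e.
Proof. by move=> lekl iso e' /(ef_le lekl)/iso. Qed.

(** The promises about the empty tuple give the limit the theory of [L], so categoricity identifies
    the two and the indices enumerate [L] itself. *)
Lemma limit_in_categorical (cs : nat -> condition L) :
  countably_categorical L ->
  (forall s t, (s <= t)%N -> extends x0 (cs s) (cs t)) ->
  (forall r, exists s, witnessed x0 r (cs s)) ->
  exists c : nat -> L,
    (forall x, exists i, c i = x) /\
    (forall s k i, in_range i (cs s) -> (k <= (cs s).2)%N ->
       ef x0 k (size i) (map c i) = ef x0 k (size i) (select x0 (cs s).1 i)).
Proof.
move=> [_ cat] ext_cs wit_cs.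
have [p [c [c_surj cE]]] := limit_order ext_cs wit_cs.
have [|//|f f_iso] := cat _ (preorder_quotient p).
- exact: countableP.
- apply: (@ef_same_theory _ _ _ _ x0 (c 0)) => k.
  by have [s [_ ltk _]] := wit_cs ([::], k, 0); rewrite (cE s k [::]) // ltnW.
exists (f \o c); split.
  move=> x; have [[g fK gK] _] := f_iso.
  by have [i ci] := c_surj (g x); exists i; rewrite /= ci gK.
move=> s k i ri lek; rewrite -(cE _ _ _ ri lek) -(ef_iso _ _ _ _ f_iso) -map_comp.
by apply: ef_ext => j ltj; apply: set_nth_default; rewrite size_map.
Qed.

(* Otherwise a generic sequence of conditions avoids the type of [e]. *)
Lemma categorical_isolating n e :
  countably_categorical L -> exists k, isolating n k e.
Proof.
move=> cat; apply: contrapT => /forallNP niso.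
have {}niso k : exists e', ef x0 k n e = ef x0 k n e' /\
    exists j, ef x0 j n e <> ef x0 j n e'.
  apply: contrapT => /forallNP no; apply: (niso k) => e' eq_e j.
  by apply: contrapT => neq; apply: (no e'); split=> //; exists j.
pose good (c : condition L) := True.
have [||grow wit] := @witness_dense _ _ x0 good.
- by move=> a k _; exists a; do 2!split=> //=.
- by [].
(* Besides the Henkin requirements, each index tuple of length [n] must be promised a type other
   than that of [e]. *)
pose D (r : (seq nat * nat * nat) + seq nat) (c : condition L) := match r with
  | inl r => witnessed x0 r c
  | inr i => size i = n -> in_range i c /\
      ef x0 c.2 n (select x0 c.1 i) <> ef x0 c.2 n e end.
have dense r c : good c -> exists c', [/\ good c', extends x0 c c' & D r c'].
  case: r => [r|i] gc; first exact: wit.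
  have [[a k] [_ ext_ca /= sza _]] := grow (\max_(j <- i) j).+1 c gc.
  have ri : in_range i (a, k).
    by apply/allP => j ji; apply: leq_trans sza; rewrite ltnS leq_bigmax_seq.
  have [[l neq_l]|eq_l] := pselect (exists l,
       ef x0 l n (select x0 a i) <> ef x0 l n e).
    exists (a, maxn k l); split=> //.
      by apply: extends_trans ext_ca _; split; rewrite //= leq_maxl.
    by move=> _; split=> //= eq_m; apply: neq_l; apply: ef_le eq_m; rewrite leq_maxr.
  (* The depth [size a + k] pays for replying to all entries of [a] and still agreeing to depth
     [k]. *)
  have [e' [eq_e' [j neq_j]]] := niso (size a + k)%N.
  have eq_sel : ef x0 (size a + k) n (select x0 a i) = ef x0 (size a + k) n e'.
    rewrite -eq_e'; apply: contrapT => neq; apply: eq_l.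
    by exists (size a + k)%N.
  have [b szb eq_ab] := ef_catl erefl eq_sel.
  exists (b, maxn k j); split=> //.
    apply: extends_trans ext_ca _; split; rewrite /= ?szb ?leq_maxl //.
    have eq_ab' := ef_take (leq_addr n (size a)) eq_ab.
    have -> : ef x0 k (size a) a = ef x0 k (size a) (a ++ select x0 a i).
      by apply: ef_ext => l ltl; rewrite nth_cat ltl.
    by rewrite eq_ab'; apply: ef_ext => l ltl; rewrite nth_cat szb ltl.
  move=> szi; split=> [|/= eq_m]; first by rewrite /in_range /= szb.
  (* In [a ++ select x0 a i] the positions [nth 0 i l] and [size a + l] hold the same point;
     equality of types forces this in [b ++ e'], so the tuple [i] of [b] is [e']. *)
  apply: neq_j; rewrite -(ef_le (leq_maxr k j) eq_m); apply: ef_ext => l ltl.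
  have /ef0P eq0 := ef_le (leq0n k) eq_ab.
  have ltia : (nth 0 i l < size a)%N by apply: (allP ri); rewrite mem_nth ?szi.
  have ltil : (nth 0 i l < size a + n)%N by rewrite ltn_addr.
  have ltal : (size a + l < size a + n)%N by rewrite ltn_add2l.
  have := eq0 _ _ ltil ltal; have := eq0 _ _ ltal ltil.
  rewrite !nth_cat szb ltia ltnNge leq_addr /= addKn (nth_map 0) ?szi // ltxx.
  move=> /esym lt1 /esym lt2; rewrite (nth_map 0) ?szi //.
  by apply/eqP; rewrite eq_le !leNgt lt1 lt2.
have [cs [_ _ ext_cs D_cs]] := @generic_sequence _ good _ _ D ([::], 0) I
  (extends_refl x0) (@extends_trans _ _ x0) dense.
have [|c [c_surj cE]] := limit_in_categorical cat ext_cs.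
  by move=> r; exact: (D_cs (inl r)).
have [h hK] := choice c_surj.
(* The indices enumerate [L], so some tuple of them names [e], whose type was omitted. *)
pose i := map h (mkseq (nth x0 e) n).
have szi : size i = n by rewrite size_map size_mkseq.
have [s /(_ szi)[ri neq_s]] := D_cs (inr i); apply: neq_s.
have := cE s _ i ri (leqnn _); rewrite szi => <-; apply: ef_ext => l ltl.
by rewrite -map_comp (nth_map x0) ?size_mkseq //= hK nth_mkseq.
Qed.

Lemma infinite_pigeonhole (F : finType) (h : nat -> F) :
  exists v, forall m, exists2 m', (m <= m')%N & h m' = v.
Proof.
apply: contrapT => /forallNP no.
have /choice [b bP] v : exists m, forall m', (m <= m')%N -> h m' <> v.
  apply: contrapT => /forallNP nb; apply: (no v) => m; apply: contrapT => nm.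
  by apply: (nb m) => m' lem eq_v; apply: nm; exists m'.
by apply: (bP (h (\max_v b v)) (\max_v b v)) => //; apply: leq_bigmax.
Qed.

(* Otherwise infinitely many types of [n]-tuples are realised, and the limit
   realises an accumulation point of them, although all types are isolated. *)
Lemma categorical_finitely_many_types n :
  countably_categorical L -> exists k, forall e, isolating n k e.
Proof.
move=> cat; apply: contrapT => /forallNP niso.
have /choice [w wP] k : exists e, ~ isolating n k e by apply/existsNP.
pose good (c : condition L) := (n <= size c.1)%N /\ forall k, exists a',
  ef x0 c.2 (size c.1) c.1 = ef x0 c.2 (size c.1) a' /\ ~ isolating n k a'.
(* There are finitely many types of depth [l], so one recurs among the [h k] for unboundedly large
   [k]; [mkseq] cuts or pads to length [m]. *)
have cluster m l (h : nat -> seq L) : (n <= m)%N ->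
    (forall k, ~ isolating n k (h k)) ->
    exists k, good (mkseq (nth x0 (h k)) m, l).
  move=> lenm hP.
  have [v vP] := infinite_pigeonhole (fun k => ef x0 l m (h k)).
  have [k0 _ eq_k0] := vP 0; exists k0; split; rewrite /= size_mkseq // => k.
  have [k' lek' eq_k'] := vP k; exists (h k'); split.
    rewrite eq_k' -eq_k0; apply: ef_ext => i lti; exact: nth_mkseq.
  by move=> /(isolating_le lek')/hP.
have [||grow wit] := @witness_dense _ _ x0 good.
- move=> a k [/= lena /choice[h hP]].
  have [k0 good_k0] := cluster (size a) k.+1 h lena (fun k => (hP k).2).
  exists (mkseq (nth x0 (h k0)) (size a)); split=> //.
  split; rewrite /= ?size_mkseq // (hP k0).1; apply: ef_ext => i lti.
  exact/esym/nth_mkseq.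
- move=> a k b [/= lena ga]; split=> /= [|l]; first by rewrite size_rcons leqW.
  have [a' [/efSP[/(_ b)[b' eq_b] _] niso_a']] := ga l.
  (* Moves the new point from the head, where the game puts it, to the end, where conditions
     append. *)
  pose i := rcons (iota 1 (size a)) 0.
  exists (map (nth x0 (b' :: a')) i); rewrite size_rcons; split.
    have -> : rcons a b = map (nth x0 (b :: a)) i.
      rewrite map_rcons; congr rcons; rewrite (iotaDl 1 0) -map_comp.
      by rewrite [LHS](esym (mkseq_nth x0 a)).
    apply: ef_reindex eq_b; first by rewrite size_rcons size_iota.
    by rewrite all_rcons /=; apply/allP => j; rewrite mem_iota add1n => /andP[].
  apply: contra_not niso_a'; apply: isolating_ef; apply: ef_ext => j ltj.
  have ltja : (j < size a)%N := leq_trans ltj lena.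
  rewrite map_rcons nth_rcons size_map size_iota ltja (nth_map 0) ?size_iota //.
  by rewrite nth_iota.
have [k0 good0] := cluster n 0 w (leqnn n) wP.
have [cs [_ good_cs ext_cs wit_cs]] :=
  generic_sequence good0 (extends_refl x0) (@extends_trans _ _ x0) wit.
have [c [_ cE]] := limit_in_categorical cat ext_cs wit_cs.
(* The first [n] points of the limit are isolated at some depth [k], but a late promise gives them
   the depth-[k] type of a tuple that is not. *)
have [k iso_k] := categorical_isolating n (map c (iota 0 n)) cat.
have [s [ris ltks _]] := wit_cs (iota 0 n, k, 0).
have [lens /(_ k)[a' [eq_a' niso_a']]] := good_cs s.
apply: niso_a'; apply: isolating_ef iso_k.
have := cE s k _ ris (ltnW ltks); rewrite size_iota => ->.
rewrite -(ef_take lens (ef_le (ltnW ltks) eq_a')); apply: ef_ext => i lti.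
by rewrite (nth_map 0) ?size_iota // nth_iota.
Qed.

End RyllNardzewski.

(** Since types of each length are decided at a finite depth, back-and-forth turns equality of types
    into an automorphism, and pairs have finitely many types of depth [K 2]. *)
Lemma finitely_many_pair_orbits (d : Order.disp_t) (L : orderType d) :
  inhabited L -> countably_categorical L ->
  exists (c : L -> L -> nat) (s : seq nat),
    (forall x y, c x y \in s) /\
    (forall x y x' y', c x y = c x' y' ->
       exists f : L -> L, [/\ order_iso f, f x = x' & f y = y']).
Proof.
move=> [x0] cat; have L_countable := cat.1.
have /choice [K KP] n := categorical_finitely_many_types x0 n cat.
exists (fun x y => val (enum_rank (ef x0 (K 2) 2 [:: x; y]))).
exists (iota 0 #|eftype (K 2) 2|); split=> [x y|x y x' y'].
  by rewrite mem_iota add0n ltn_ord.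
move=> /val_inj/enum_rank_inj/(KP 2) eq_xy.
pose P (s : seq (L * L)) :=
  forall j, ef x0 j (size s) (unzip1 s) = ef x0 j (size s) (unzip2 s).
have [|||||f [_ f_mono f_surj _ f_s0]] :=
  @back_and_forth _ _ L L (fun=> True) (fun=> True) P [:: (x, x'); (y, y')]
    L_countable L_countable (inhabits x0).
- exact: eq_xy.
- by [].
- move=> s p q Ps ps qs.
  have /ef0P/(_ (index p s) (index q s)) := Ps 0; rewrite !index_mem ps qs.
  by rewrite !(nth_map p) ?index_mem ?ps ?qs // !nth_index // => ->.
(* One round finds the reply; the depth that remains decides types of the lengthened tuple. *)
- move=> s z Ps _; have /efSP[/(_ z)[z' eq_z] _] := Ps (K (size s).+1).+1.
  by exists z' => j; apply: KP eq_z j.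
- move=> s z Ps _; have /efSP[_ /(_ z)[z' eq_z]] := Ps (K (size s).+1).+1.
  by exists z' => j; apply: KP eq_z j.
have f_inj : injective f.
  move=> u v eq_f; apply/eqP; rewrite eq_le !leNgt.
  by rewrite -(f_mono u v) // -(f_mono v u) // eq_f ltxx.
exists f; split.
- split; last by move=> u v; exact: f_mono.
  have /choice [g gK] : forall v, exists u, f u = v.
    by move=> v; have [u _ fu] := f_surj v I; exists u.
  by exists g => // u; apply: f_inj; rewrite gK.
- by apply: (f_s0 (x, x')); rewrite mem_head.
- by apply: (f_s0 (y, y')); rewrite !inE eqxx orbT.
Qed.

(** * Condensation of coloured orders *)

HB.instance Definition _ := gen_eqMixin tree.

Definition colour_automorphism (d : Order.disp_t) (Q : orderType d)
    (col : Q -> tree) (f : Q -> Q) : Prop :=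
  order_iso f /\ forall x, col (f x) = col x.

(** Bounds the number of orbits without forming them: [c] separates orbits, but need not be constant
    on one. *)
Definition pair_orbits_le (d : Order.disp_t) (Q : orderType d)
    (col : Q -> tree) (N : nat) : Prop :=
  exists (c : Q -> Q -> nat) (s : seq nat),
    [/\ (size s <= N)%N, forall x y, c x y \in s
      & forall x y x' y', c x y = c x' y' ->
          exists f, [/\ colour_automorphism col f, f x = x' & f y = y']].

Section Automorphisms.
Variables (d : Order.disp_t) (Q : orderType d) (col : Q -> tree).

Lemma colour_automorphism_inv f : colour_automorphism col f ->
  exists g, [/\ colour_automorphism col g, cancel f g & cancel g f].
Proof.
move=> [[[g fK gK] f_mono] f_col]; exists g; split=> //; split; last first.
  by move=> x; rewrite -f_col gK.
by split; [exists f | move=> x y; rewrite -f_mono !gK].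
Qed.

Lemma order_iso_le f : order_iso f -> {mono f : x y / x <= y :> Q}.
Proof. by move=> [_ f_mono] x y; rewrite !leNgt f_mono. Qed.

End Automorphisms.

Section Condensation.
Variables (d : Order.disp_t) (Q : orderType d) (col : Q -> tree).

Definition near (x y : Q) : Prop :=
  exists s : seq Q, forall z, (x <= z <= y) || (y <= z <= x) -> z \in s.

(** The ends are allowed as [u] and [v], so the colours inside accumulate at both ends; hence
    shuffled classes have no first or last point. *)
Definition shuffled (a b : Q) : Prop :=
  forall u v w, a <= u -> u < v -> v <= b -> a < w < b ->
    exists2 w', u < w' < v & col w' = col w.

(** Not reflexive: [coshuffled x x] says that [x] lies inside some shuffled interval, and later
    decides between shuffle and sum. *)
Definition coshuffled (x y : Q) : Prop :=
  exists a b, [/\ shuffled a b, a < x < b & a < y < b].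

Definition condensed (x y : Q) : Prop := near x y \/ coshuffled x y.

Lemma near_refl x : near x x.
Proof. by exists [:: x] => z; rewrite orbb inE eq_sym eq_le. Qed.

Lemma near_sym x y : near x y -> near y x.
Proof. by move=> [s sP]; exists s => z; rewrite orbC; apply: sP. Qed.

Lemma near_trans x y z : near x y -> near y z -> near x z.
Proof.
move=> [s sP] [t tP]; exists (s ++ t) => w; rewrite mem_cat.
have [lewy|/ltW leyw] := leP w y.
  move=> /orP[/andP[xw _]|/andP[zw _]]; apply/orP.
    by left; apply: sP; rewrite xw lewy.
  by right; apply: tP; rewrite zw lewy orbT.
move=> /orP[/andP[_ wz]|/andP[_ wx]]; apply/orP.
  by right; apply: tP; rewrite leyw wz.
by left; apply: sP; rewrite leyw wx orbT.
Qed.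

Lemma coshuffled_sym x y : coshuffled x y -> coshuffled y x.
Proof. by move=> [a [b [? ? ?]]]; exists a, b. Qed.

Lemma shuffled_meet a b u v w : shuffled a b -> u < v -> u < b -> a < v ->
  a < w < b -> exists2 w', u < w' < v & col w' = col w.
Proof.
move=> sh uv ub av wab; have [w' /andP[]] : exists2 w',
    Order.max a u < w' < Order.min v b & col w' = col w.
  apply: sh => //; rewrite ?le_max ?lexx ?ge_min ?lexx ?orbT //.
  rewrite lt_min !gt_max av uv ub; have /andP[aw wb] := wab.
  by rewrite (lt_trans aw wb).
rewrite gt_max lt_min => /andP[_ uw'] /andP[w'v _] eq_col.
by exists w' => //; rewrite uw' w'v.
Qed.

(** The overlap around [y] contains every colour of either interval, so both have the same colours;
    and an interval [(u, v)] within the union meets one of the two. *)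
Lemma shuffled_join a b a' b' y : shuffled a b -> shuffled a' b' ->
  a < y < b -> a' < y < b' -> shuffled (Order.min a a') (Order.max b b').
Proof.
move=> sh sh' /andP[ay yb] /andP[a'y yb'] u v w; rewrite ge_min le_max.
move=> au uv vb; rewrite gt_min lt_max => /andP[aw wb].
have ab' := lt_trans ay yb'; have a'b := lt_trans a'y yb.
have win : (a < w < b) || (a' < w < b').
  have [lewa|ltaw] /= := leP w a.
    by rewrite ltNge lewa /= in aw; rewrite aw (le_lt_trans lewa ab').
  have [lebw|//] := leP b w; rewrite ltNge lebw /= in wb.
  by rewrite wb (lt_le_trans a'b lebw).
have mate : exists2 w', a < w' < b & col w' = col w.
  case/orP: win => [wab|wab']; first by exists w.
  exact: (shuffled_meet sh' (lt_trans ay yb)).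
have mate' : exists2 w', a' < w' < b' & col w' = col w.
  case/orP: win => [wab|wab']; last by exists w.
  exact: (shuffled_meet sh (lt_trans a'y yb')).
have [w1 w1P eq_w1] := mate; have [w2 w2P eq_w2] := mate'.
have [/andP[ltub ltav]|nab] := boolP ((u < b) && (a < v)).
  by rewrite -eq_w1; apply: shuffled_meet w1P.
have [/andP[ltub ltav]|nab'] := boolP ((u < b') && (a' < v)).
  by rewrite -eq_w2; apply: shuffled_meet w2P.
suff : false by [].
move: nab nab'; rewrite !negb_and -!leNgt => /orP[bu|va] /orP[b'u|va'].
- by case/orP: vb => vb; have := lt_le_trans uv vb; rewrite ltNge ?bu ?b'u.
- by have := lt_trans (le_lt_trans bu uv) (le_lt_trans va' a'b); rewrite ltxx.
- by have := lt_trans (le_lt_trans b'u uv) (le_lt_trans va ab'); rewrite ltxx.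
- by case/orP: au => au; have := le_lt_trans au uv; rewrite ltNge ?va ?va'.
Qed.

Lemma coshuffled_trans x y z :
  coshuffled x y -> coshuffled y z -> coshuffled x z.
Proof.
move=> [a [b [sh xab yab]]] [a' [b' [sh' ya'b' za'b']]].
exists (Order.min a a'), (Order.max b b').
rewrite !gt_min !lt_max; split; first exact: shuffled_join sh' yab ya'b'.
  by have /andP[-> ->] := xab.
by have /andP[-> ->] := za'b'; rewrite !orbT.
Qed.

Lemma coshuffled_id x y : coshuffled x y -> coshuffled x x.
Proof. by move=> [a [b [? ? _]]]; exists a, b. Qed.

Lemma dense_segment_infinite (lo hi : Q) (s : seq Q) : lo < hi ->
  (forall u v, lo <= u -> u < v -> v <= hi -> exists w, u < w < v) ->
  exists2 z, lo <= z <= hi & z \notin s.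
Proof.
have [n] := ubnP (size s); elim: n s hi => // n IHn s hi szs lohi dense.
have [his|hins] := boolP (hi \in s); last by exists hi; rewrite ?lexx ?(ltW lohi).
have [w /andP[low whi]] := dense lo hi (lexx _) lohi (lexx _).
have [|||z /andP[loz zw] zs] := IHn [seq z <- s | z != hi] w.
- rewrite -ltnS; apply: leq_trans szs.
  rewrite ltnS size_filter -(count_predC (pred1 hi) s).
  by rewrite -addn1 addnC leq_add2r -has_count has_pred1.
- by [].
- by move=> u v lou uv vw; apply: dense => //; apply: le_trans vw (ltW whi).
exists z; first by rewrite loz (le_trans zw (ltW whi)).
by move: zs; rewrite mem_filter (lt_eqF (le_lt_trans zw whi)).
Qed.

(** A shuffled interval is dense, so infinitely many points lie between [x] and any other point. The
    two relations thus never mix, which makes their union transitive. *)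
Lemma coshuffled_near x y : coshuffled x x -> near x y -> x = y.
Proof.
move=> [a [b [sh xab _]]] [s sP]; have /andP[ax xb] := xab.
have dense u v : a <= u -> u < v -> v <= b -> exists w, u < w < v.
  by move=> au uv vb; have [w uwv _] := sh u v x au uv vb xab; exists w.
case: (ltgtP x y) => // [xy|yx].
  have xyb : x < Order.min y b by rewrite lt_min xy xb.
  have [|z /andP[xz]] := @dense_segment_infinite _ _ s xyb.
    move=> u v xu uv; rewrite le_min => /andP[_ vb].
    by apply: dense => //; apply: le_trans (ltW ax) xu.
  by rewrite le_min => /andP[zy _]; rewrite sP // xz zy.
have ayx : Order.max y a < x by rewrite gt_max yx ax.
have [|z /andP[]] := @dense_segment_infinite _ _ s ayx.
  move=> u v; rewrite ge_max => /andP[_ au] uv vx.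
  by apply: dense => //; apply: le_trans vx (ltW xb).
by rewrite ge_max => /andP[yz _] zx; rewrite sP // yz zx orbT.
Qed.

Lemma condensed_refl x : condensed x x.
Proof. by left; apply: near_refl. Qed.

Lemma condensed_sym x y : condensed x y -> condensed y x.
Proof. by case=> [/near_sym|/coshuffled_sym]; [left|right]. Qed.

Lemma condensed_trans x y z : condensed x y -> condensed y z -> condensed x z.
Proof.
case=> xy; case=> yz.
- by left; apply: near_trans xy yz.
- by rewrite -(coshuffled_near (coshuffled_id yz) (near_sym xy)); right.
- have /coshuffled_near/(_ yz) <- := coshuffled_id (coshuffled_sym xy).
  by right.
- by right; apply: coshuffled_trans xy yz.
Qed.

Lemma condensed_coshuffled x y : coshuffled x x -> condensed x y -> coshuffled x y.
Proof. by move=> xx [/(coshuffled_near xx) <-|]. Qed.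

Lemma condensed_near x y : ~ coshuffled x x -> condensed x y -> near x y.
Proof. by move=> nxx [|/coshuffled_id]. Qed.

Lemma condensed_convex x y z : x <= y -> y <= z -> condensed x z -> condensed x y.
Proof.
move=> xy yz [[s sP]|[a [b [sh /andP[ax xb] /andP[az zb]]]]].
  left; exists s => w /orP[/andP[xw wy]|/andP[yw wx]]; apply: sP.
    by rewrite xw (le_trans wy yz).
  by rewrite (le_trans xy yw) (le_trans wx (le_trans xy yz)).
right; exists a, b; split=> //; first by rewrite ax xb.
by rewrite (lt_le_trans ax xy) (le_lt_trans yz zb).
Qed.

Lemma condensed_mono x y x' y' : condensed x x' -> condensed y y' ->
  ~ condensed x y -> x < y -> x' < y'.
Proof.
move=> xx' yy' nxy xy; rewrite ltNge; apply/negP => y'x'; apply: nxy.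
have [yx'|/ltW x'y] := leP y x'; first exact: condensed_convex (ltW xy) yx' xx'.
have y'x := condensed_convex y'x' x'y (condensed_sym yy').
apply: condensed_trans xx' _; apply: condensed_sym; exact: condensed_trans yy' y'x.
Qed.

Section Invariance.
Variable f : Q -> Q.
Hypothesis f_auto : colour_automorphism col f.

Lemma near_automorphism x y : near x y -> near (f x) (f y).
Proof.
have [g [_ fK gK]] := colour_automorphism_inv f_auto.
have fle := order_iso_le f_auto.1.
move=> [s sP]; exists (map f s) => z; rewrite -(gK z) !fle => /sP.
exact: map_f.
Qed.

Lemma coshuffled_automorphism x y : coshuffled x y -> coshuffled (f x) (f y).
Proof.
have [g [[[_ glt] gcol] fK gK]] := colour_automorphism_inv f_auto.
have [[_ flt] fcol] := f_auto; have fle := order_iso_le f_auto.1.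
move=> [a [b [sh xab yab]]]; exists (f a), (f b); rewrite !flt; split=> //.
move=> u v w; rewrite -(gK u) -(gK v) -(gK w) !fle !flt => au uv vb wab.
have [w' w'uv eq_w'] := sh _ _ _ au uv vb wab.
by exists (f w'); rewrite ?flt // !fcol.
Qed.

Lemma condensed_automorphism x y : condensed x y -> condensed (f x) (f y).
Proof. by case=> [/near_automorphism|/coshuffled_automorphism]; [left|right]. Qed.

End Invariance.

Lemma coshuffled_automorphismE f x y : colour_automorphism col f ->
  coshuffled (f x) (f y) <-> coshuffled x y.
Proof.
move=> f_auto; split; last exact: coshuffled_automorphism.
have [g [g_auto fK gK]] := colour_automorphism_inv f_auto.
by move=> /(coshuffled_automorphism g_auto); rewrite !fK.
Qed.

Lemma near_automorphismE f x y : colour_automorphism col f ->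
  near (f x) (f y) <-> near x y.
Proof.
move=> f_auto; split; last exact: near_automorphism.
have [g [g_auto fK gK]] := colour_automorphism_inv f_auto.
by move=> /(near_automorphism g_auto); rewrite !fK.
Qed.

Lemma finite_injection_onto (T : eqType) (A : pred T) (s : seq T) (h : T -> T) p :
  (forall z, A z -> z \in s) -> {in A &, injective h} ->
  (forall z, A z -> A (h z)) -> A p -> exists2 z, A z & h z = p.
Proof.
move=> As h_inj hA Ap; pose t := undup (filter A s).
have tE z : (z \in t) = A z.
  by rewrite mem_undup mem_filter; case: (boolP (A z)) => // /As ->.
have ut : uniq (map h t).
  rewrite map_inj_in_uniq ?undup_uniq // => u v; rewrite !tE; exact: h_inj.
have subt : {subset map h t <= t}.
  by move=> z /mapP[u ut' ->]; rewrite tE hA // -tE.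
have [_] := uniq_min_size ut subt (eq_leq (esym (size_map h t))).
move=> /(_ p); rewrite tE Ap => /mapP[z].
by rewrite tE => Az ->; exists z.
Qed.

(* An automorphism fixing [x] maps a finite segment starting at [x] to another
   one, of the same cardinality. *)
Lemma near_fixed f x y : colour_automorphism col f -> f x = x -> near x y ->
  f y = y.
Proof.
(* Below [x] the map [h] sends [[u, x]] into itself, above [x] its inverse sends [[x, h u]] into
   itself; by finiteness the injection is onto, against [u < h u]. Applied to [f] and to its
   inverse, this excludes motion either way. *)
have noup h u : colour_automorphism col h -> h x = x -> near x u -> ~~ (u < h u).
  move=> h_auto hx xu; apply/negP => ultu.
  have [g [g_auto hK gK]] := colour_automorphism_inv h_auto.
  have gx : g x = x by rewrite -{1}hx hK.
  have hle := order_iso_le h_auto.1; have gle := order_iso_le g_auto.1.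
  have [leux|/ltW lexu] := leP u x.
    have [s sP] := xu.
    have [||||z /andP[uz zx] hz] :=
      @finite_injection_onto _ (fun z => u <= z <= x) s h u.
    - by move=> z zP; apply: sP; rewrite zP orbT.
    - by move=> z z' _ _; apply: can_inj hK _ _.
    - move=> z /andP[uz zx]; rewrite -{1}hx hle zx andbT.
      by apply: le_trans (ltW ultu) _; rewrite hle.
    - by rewrite lexx leux.
    by move: ultu; rewrite ltNge -{2}hz hle uz.
  have [s sP] : near x (h u).
    by rewrite -{1}hx; apply: near_automorphism xu.
  have [||||z /andP[xz zu] gz] :=
    @finite_injection_onto _ (fun z => x <= z <= h u) s g (h u).
  - by move=> z zP; apply: sP; rewrite zP.
  - by move=> z z' _ _; apply: can_inj gK _ _.
  - move=> z /andP[xz zu]; rewrite -{1}gx gle xz /=.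
    by rewrite -gle hK in zu; apply: le_trans zu (ltW ultu).
  - by rewrite lexx (le_trans lexu (ltW ultu)).
  by move: ultu; rewrite -gz ltNge -{1}(hK u) gle zu.
move=> f_auto fx xy; have [g [g_auto fK gK]] := colour_automorphism_inv f_auto.
have gx : g x = x by rewrite -{1}fx fK.
apply/eqP; rewrite eq_le leNgt noup //= leNgt.
have := noup g (f y) g_auto gx; rewrite fK; apply.
by rewrite -{1}fx; apply: near_automorphism xy.
Qed.

End Condensation.

(** * Finiteness and density tools for a condensation step *)

Lemma list_of_finite_values (T : Type) (U : eqType) (A : T -> Prop)
    (v : T -> U) (c : T -> nat) (s : seq nat) :
  (forall x y, A x -> A y -> c x = c y -> v x = v y) ->
  exists l : seq U, forall x, A x -> c x \in s -> v x \in l.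
Proof.
move=> cv; elim: s => [|k s [l lP]]; first by exists [::].
have [[x [Ax xk]]|nx] := pselect (exists x, A x /\ c x = k).
  exists (v x :: l) => y Ay; rewrite !inE => /orP[/eqP yk|/(lP _ Ay) ->].
    by rewrite (cv y x) ?eqxx // xk.
  by rewrite orbT.
exists l => y Ay; rewrite inE => /orP[/eqP yk|]; last exact: lP.
by case: nx; exists y.
Qed.

(** What extending a finite order-preserving map by one point requires; the last clause covers the
    empty map. *)
Definition dense_in (d : Order.disp_t) (Y : orderType d) (D p : Y -> Prop) : Prop :=
  [/\ forall u v, D u -> D v -> u < v -> exists2 w, p w & u < w < v,
      forall u, D u -> exists2 w, p w & u < w,
      forall u, D u -> exists2 w, p w & w < u
    & exists u, p u].

Lemma finite_gap (d : Order.disp_t) (Y : orderType d) (D p : Y -> Prop)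
    (A B : seq Y) :
  dense_in D p -> (forall u, u \in A ++ B -> D u) ->
  (forall u v, u \in A -> v \in B -> u < v) ->
  exists2 w, p w & (forall u, u \in A -> u < w) /\ (forall v, v \in B -> w < v).
Proof.
move=> [dense up down [u0 pu0]] DAB AB.
have maxA (s : seq Y) : s = [::] \/ exists2 m, m \in s & forall u, u \in s -> u <= m.
  elim: s => [|u s [->|[m ms mP]]]; [by left|right; exists u; rewrite ?inE //|].
    by move=> v; rewrite inE => /eqP ->.
  right; exists (Order.max u m).
    by rewrite inE; case: leP => _; rewrite ?eqxx ?ms ?orbT.
  by move=> v; rewrite inE le_max => /orP[/eqP ->|/mP ->]; rewrite ?lexx ?orbT.
have minB (s : seq Y) : s = [::] \/ exists2 m, m \in s & forall u, u \in s -> m <= u.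
  elim: s => [|u s [->|[m ms mP]]]; [by left|right; exists u; rewrite ?inE //|].
    by move=> v; rewrite inE => /eqP ->.
  right; exists (Order.min u m).
    by rewrite inE; case: leP => _; rewrite ?eqxx ?ms ?orbT.
  by move=> v; rewrite inE ge_min => /orP[/eqP ->|/mP ->]; rewrite ?lexx ?orbT.
have DA u : u \in A -> D u by move=> uA; apply: DAB; rewrite mem_cat uA.
have DB u : u \in B -> D u by move=> uB; apply: DAB; rewrite mem_cat uB orbT.
have [A0|[a aA aP]] := maxA A; have [B0|[b bB bP]] := minB B.
- by exists u0; rewrite // A0 B0.
- have [w pw wb] := down b (DB _ bB); exists w; rewrite // A0; split=> // v /bP.
  exact: lt_le_trans.
- have [w pw aw] := up a (DA _ aA); exists w; rewrite // B0; split=> // u /aP ua.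
  exact: le_lt_trans ua aw.
- have [w pw /andP[aw wb]] := dense a b (DA _ aA) (DB _ bB) (AB _ _ aA bB).
  exists w => //; split; first by move=> u /aP ua; apply: le_lt_trans ua aw.
  by move=> v /bP; apply: lt_le_trans.
Qed.

Definition partial_iso (d d' : Order.disp_t) (X : orderType d) (Y : orderType d')
    (s : seq (X * Y)) : Prop :=
  forall q r, q \in s -> r \in s -> (q.1 < r.1) = (q.2 < r.2).

(** Density fills the gap that [s] leaves for [x]; if [x] is already paired, its value must be kept,
    hence the alternative. *)
Lemma extend_partial_iso (d d' : Order.disp_t) (X : orderType d)
    (Y : orderType d') (D p : Y -> Prop) (s : seq (X * Y)) (x : X) :
  dense_in D p -> (forall q, q \in s -> D q.2) -> partial_iso s ->
  exists2 w, (x, w) \in s \/ p w & partial_iso ((x, w) :: s).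
Proof.
move=> p_dense Ds iso_s.
have [[[x' w] ws /= xE]|nx] := pselect (exists2 q, q \in s & q.1 = x).
  exists w; first by left; rewrite -xE.
  by move=> q r; rewrite !inE -xE => /predU1P[->|qs] /predU1P[->|rs]; apply: iso_s.
have neqx q : q \in s -> (q.1 == x) = false.
  by move=> qs; apply/eqP => eqx; apply: nx; exists q.
have [||w pw [Aw Bw]] := @finite_gap _ _ D p
    [seq q.2 | q <- s & q.1 < x] [seq q.2 | q <- s & x < q.1] p_dense.
- by move=> u; rewrite mem_cat => /orP[] /mapP[q];
    rewrite mem_filter => /andP[_ /Ds Dq] ->.
- move=> u v /mapP[q]; rewrite mem_filter => /andP[qx qs] ->.
  move=> /mapP[r]; rewrite mem_filter => /andP[xr rs] ->.
  by rewrite -iso_s // (lt_trans qx xr).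
have {}Aw q : q \in s -> q.1 < x -> q.2 < w.
  by move=> qs qx; apply/Aw/map_f; rewrite mem_filter qx.
have {}Bw q : q \in s -> x < q.1 -> w < q.2.
  by move=> qs qx; apply/Bw/map_f; rewrite mem_filter qx.
exists w; first by right.
move=> q r; rewrite !inE => /predU1P[->|qs] /predU1P[->|rs] /=.
- by rewrite !ltxx.
- have := neqx r rs; case: (ltgtP r.1 x) => // [rx|xr] _.
    by rewrite [RHS]ltNge ltW // Aw.
  by rewrite Bw.
- have := neqx q qs; case: (ltgtP q.1 x) => // [qx|xq] _; first by rewrite Aw.
  by rewrite [RHS]ltNge ltW // Bw.
- exact: iso_s.
Qed.

Lemma count_lt (T : eqType) (p q : pred T) (s : seq T) t :
  (forall u, p u -> q u) -> t \in s -> ~~ p t -> q t -> (count p s < count q s)%N.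
Proof.
move=> pq ts npt qt; elim: s ts => // u s IHs; rewrite inE /=.
have [<- _|_ /=] := eqVneq t u.
  by rewrite (negbTE npt) qt add0n add1n ltnS; apply: sub_count.
move=> /IHs lts; rewrite -addnS leq_add //.
by case: (boolP (p u)) => // /pq ->.
Qed.

(** * One condensation step: children, positions and coordinates *)

Section CondensationStep.
Variables (d : Order.disp_t) (Q : orderType d) (col : Q -> tree) (N : nat).
Hypothesis orbits : pair_orbits_le col N.

Local Notation near := (@near _ Q).
Local Notation coshuffled := (coshuffled col).
Local Notation condensed := (condensed col).

(** An automorphism fixing [x] fixes each [y] near [x], so [y] is determined by the orbit of
    [(x, y)]. *)
Lemma near_class x : exists l : seq Q,
  sorted <%O l /\ forall y, (y \in l) = `[< near x y >].
Proof.
have [c [s [_ cs c_orb]]] := orbits.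
have [|l lP] := @list_of_finite_values Q Q (near x) id (c x) s.
  move=> y y' xy _ /c_orb[f [f_auto fx <-]].
  by rewrite [f y](near_fixed f_auto fx xy).
exists (sort <=%O (undup [seq y <- l | `[< near x y >]])).
rewrite sort_lt_sorted undup_uniq; split=> // y.
rewrite mem_sort mem_undup mem_filter; case: asboolP => // xy.
by rewrite lP.
Qed.

Lemma finitely_many_colours : exists C : seq tree, uniq C /\ forall x, col x \in C.
Proof.
have [c [s [_ cs c_orb]]] := orbits.
have [|C CP] := @list_of_finite_values Q tree (fun=> True) col (fun x => c x x) s.
  by move=> x y _ _ /c_orb[f [[_ f_col] <- _]]; rewrite f_col.
by exists (undup C); rewrite undup_uniq; split=> // x; rewrite mem_undup CP.
Qed.

(* In a dense order, an open interval with the least number of colours is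
   shuffled. *)
Lemma condensed_nontrivial (x0 y0 : Q) : x0 < y0 ->
  exists x y, x <> y /\ condensed x y.
Proof.
move=> x0y0.
have [[x [y [xy gap]]]|dense] := pselect (exists x y : Q, x < y /\
    forall z, ~~ (x < z < y)).
  exists x, y; split; first by move=> exy; rewrite exy ltxx in xy.
  left; exists [:: x; y] => z /orP[/andP[xz zy]|/andP[yz zx]]; last first.
    by have := lt_le_trans xy (le_trans yz zx); rewrite ltxx.
  have := gap z; rewrite !inE !lt_neqAle xz zy !andbT negb_and !negbK.
  by rewrite [x == z]eq_sym.
have {}dense (x y : Q) : x < y -> exists z, x < z < y.
  move=> xy; apply: contrapT => nz; apply: dense; exists x, y; split=> // z.
  by apply/negP => xzy; apply: nz; exists z.
have [C [_ CP]] := finitely_many_colours.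
pose occurs a b t := `[< exists2 w, a < w < b & col w = t >].
have ex : exists n, `[< exists a b : Q, a < b /\ count (occurs a b) C = n >].
  by exists (count (occurs x0 y0) C); apply/asboolP; exists x0, y0.
case: (ex_minnP ex) => n /asboolP[a [b [ab cntab]]] minn.
have sh : shuffled col a b.
  move=> u v w au uv vb wab; apply: contrapT => nw.
  have /minn : `[< exists a b : Q, a < b /\
      count (occurs a b) C = count (occurs u v) C >].
    by apply/asboolP; exists u, v.
  apply/negP; rewrite -ltnNge -cntab.
  have sub : forall t, occurs u v t -> occurs a b t.
    move=> t /asboolP[w' /andP[uw' w'v] eq_t]; apply/asboolP; exists w' => //.
    by rewrite (le_lt_trans au uw') (lt_le_trans w'v vb).
  have nuv : ~~ occurs u v (col w).
    by apply/asboolP => -[w' w'uv eq_w']; apply: nw; exists w'.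
  have oab : occurs a b (col w) by apply/asboolP; exists w.
  exact: count_lt sub (CP w) nuv oab.
have [x /andP[ax xb]] := dense a b ab.
have [y /andP[xy yb]] := dense x b xb.
exists x, y; split; first by move=> exy; rewrite exy ltxx in xy.
by right; exists a, b; rewrite ax xb (lt_trans ax xy) yb.
Qed.

Lemma representatives : exists rep : Q -> Q,
  (forall x, condensed x (rep x)) /\ (forall x y, condensed x y -> rep x = rep y).
Proof.
exists (fun x => choose (fun y => `[< condensed x y >]) x).
have refl x : `[< condensed x x >] by apply/asboolP/condensed_refl.
split=> [x|x y xy].
  exact: (asboolP _ (@chooseP _ (fun y => `[< condensed x y >]) x (refl x))).
have eq_class : (fun z => `[< condensed x z >]) =1 (fun z => `[< condensed y z >]).
  move=> z; apply/asboolP/asboolP; apply: condensed_trans => //.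
  exact: condensed_sym.
rewrite (eq_choose eq_class); apply: choose_id => //.
exact/asboolP/condensed_sym.
Qed.

(* [ch x] lists the children of the tree colouring the class of [x], and [pos x]
   is the place of [x] in that list; they depend on the coloured order only. *)
Lemma condensation_colour :
  exists (ch : Q -> seq tree) (pos : Q -> nat),
    [/\ forall x, onth (ch x) (pos x) = Some (col x),
        forall x y, condensed x y -> ch x = ch y,
        (forall f x, colour_automorphism col f ->
           ch (f x) = ch x /\ pos (f x) = pos x),
        (forall x, coshuffled x x ->
           (forall y, coshuffled x y -> pos y = index (col y) (ch x)) /\
           (forall k, (k < size (ch x))%N ->
              exists2 y, coshuffled x y & pos y = k))
      & (forall x, ~ coshuffled x x ->
           (forall y, near x y -> x < y -> (pos x < pos y)%N) /\
           (forall k, (k < size (ch x))%N -> exists2 y, near x y & pos y = k))].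
Proof.
have /choice [cl clP] := near_class.
have [C [uC CP]] := finitely_many_colours.
have clE x y : (y \in cl x) = `[< near x y >] by have [_ ->] := clP x.
have cl_eq x y : near x y -> cl x = cl y.
  move=> xy; apply: lt_sorted_eq; [exact: (clP x).1|exact: (clP y).1|].
  move=> z; rewrite !clE; apply/asboolP/asboolP; apply: near_trans => //.
  exact: near_sym.
have clx x : x \in cl x by rewrite clE; apply/asboolP/near_refl.
(* Filtering one fixed list [C] orders the children of a shuffle in a way that depends on its set of
   colours alone. *)
pose kc x := [seq t <- C | `[< exists2 y, coshuffled x y & col y = t >]].
have kcP x y : coshuffled x y -> col y \in kc x.
  by move=> xy; rewrite mem_filter CP andbT; apply/asboolP; exists y.
have kc_eq x y : coshuffled x y -> kc x = kc y.
  move=> xy; apply: eq_filter => t.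
  apply/asboolP/asboolP => -[z xz eq_t]; exists z => //.
    exact: coshuffled_trans (coshuffled_sym xy) xz.
  exact: coshuffled_trans xy xz.
pose sh x := `[< coshuffled x x >].
have sh_eq x y : condensed x y -> sh x = sh y.
  move=> xy; apply/asboolP/asboolP => zz.
    exact/coshuffled_id/coshuffled_sym/(condensed_coshuffled zz xy).
  exact/coshuffled_id/coshuffled_sym/(condensed_coshuffled zz)/condensed_sym.
pose ch x := if sh x then kc x else map col (cl x).
(* Points of one colour share a position in a shuffle; in a finite class each point has its own
   child, repeated colours included. *)
pose pos x := if sh x then index (col x) (kc x) else index x (cl x).
exists ch, pos; split.
- move=> x; rewrite /ch /pos /sh; case: asboolP => xx.
    have colx := kcP x x xx.
    by rewrite onthE (nth_map (col x)) ?index_mem // nth_index.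
  by rewrite onth_map onthE (nth_map x) ?index_mem //= nth_index.
- move=> x y xy; rewrite /ch -(sh_eq x y xy) /sh; case: asboolP => xx.
    exact/kc_eq/condensed_coshuffled.
  by rewrite (cl_eq x y) //; apply: condensed_near xy.
- move=> f x f_auto; have [g [g_auto fK gK]] := colour_automorphism_inv f_auto.
  have shf : sh (f x) = sh x.
    by apply: asbool_equiv_eq; exact: (coshuffled_automorphismE x x f_auto).
  have kcf : kc (f x) = kc x.
    apply: eq_filter => t; apply/asboolP/asboolP => -[y xy eq_t].
      exists (g y); last by rewrite g_auto.2.
      by apply/(coshuffled_automorphismE _ _ f_auto); rewrite gK.
    exists (f y); last by rewrite f_auto.2.
    exact/(coshuffled_automorphismE _ _ f_auto).
  have clf : cl (f x) = map f (cl x).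
    apply: lt_sorted_eq; first exact: (clP _).1.
      by rewrite (mono_sorted f_auto.1.2); exact: (clP x).1.
    move=> y; rewrite -(gK y) (mem_map (can_inj fK)) !clE.
    by apply: asbool_equiv_eq; exact: (near_automorphismE _ _ f_auto).
  rewrite /ch /pos shf kcf clf f_auto.2 (index_map (can_inj fK)) -map_comp.
  split=> //; congr (if _ then _ else _); apply: eq_map => y /=.
  exact: f_auto.2.
- move=> x xx; have shx : sh x by apply/asboolP.
  have posy y : coshuffled x y -> pos y = index (col y) (ch x).
    move=> xy; rewrite /pos /ch -(sh_eq x y (or_intror xy)) shx.
    by rewrite (kc_eq x y xy).
  split=> // k; rewrite {1}/ch shx => ltk.
  have : nth TLeaf (kc x) k \in kc x by rewrite mem_nth.
  rewrite {2}/kc mem_filter => /andP[/asboolP[y xy eq_y] _]; exists y => //.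
  by rewrite posy // eq_y /ch shx index_uniq // filter_uniq.
- move=> x nxx; have shx : sh x = false by apply/asboolP.
  have posy y : near x y -> pos y = index y (cl x).
    move=> xy; rewrite /pos -(sh_eq x y (or_introl xy)) shx.
    by rewrite (cl_eq x y xy).
  have /andP[ucl scl] := lt_sorted_is_uniq_le (clP x).1.
  split=> [y xy|k]; last first.
    rewrite /ch shx size_map => ltk.
    have : nth x (cl x) k \in cl x by rewrite mem_nth.
    rewrite clE => /asboolP xy; exists (nth x (cl x) k) => //.
    by rewrite posy // index_uniq.
  have ycl : y \in cl x by rewrite clE; apply/asboolP.
  rewrite (posy x (near_refl x)) posy // => xlty.
  rewrite ltnNge; apply/negP => leyx.
  have : nth x (cl x) (index y (cl x)) <= nth x (cl x) (index x (cl x)).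
    by apply: (le_sorted_leq_nth x scl) leyx; rewrite inE index_mem.
  by rewrite !nth_index // leNgt xlty.
Qed.

Lemma coshuffled_interval x u v w :
  coshuffled x u -> coshuffled x v -> coshuffled x w ->
  exists a b, [/\ shuffled col a b, a < x < b, a < u < b, a < v < b & a < w < b].
Proof.
have join a b y z : shuffled col a b -> a < y < b -> coshuffled y z ->
    exists a' b', [/\ shuffled col a' b', a' < z < b', a' <= a & b <= b'].
  move=> sh yab [a' [b' [sh' yab' /andP[az zb]]]].
  exists (Order.min a a'), (Order.max b b').
  rewrite gt_min lt_max az zb ge_min le_max !lexx !orbT; split=> //.
  exact: shuffled_join sh' yab yab'.
have mono (a b a' b' y : Q) : a' <= a -> b <= b' -> a < y < b -> a' < y < b'.
  move=> le1 le2 /andP[ay yb].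
  by rewrite (le_lt_trans le1 ay) (lt_le_trans yb le2).
move=> [a [b [sh xab uab]]] xv xw.
have [a1 [b1 [sh1 vab1 lea1 leb1]]] := join a b x v sh xab xv.
have {}xab := mono _ _ _ _ _ lea1 leb1 xab.
have {}uab := mono _ _ _ _ _ lea1 leb1 uab.
have [a2 [b2 [sh2 wab2 lea2 leb2]]] := join a1 b1 x w sh1 xab xw.
by exists a2, b2; split=> //; apply: (mono a1 b1).
Qed.

Lemma coshuffled_dense x (p : Q -> Prop) :
  (forall y z, coshuffled x y -> coshuffled x z -> col y = col z -> p y -> p z) ->
  (exists2 y, coshuffled x y & p y) ->
  dense_in (coshuffled x) (fun y => coshuffled x y /\ p y).
Proof.
move=> p_col [y xy py].
have inside a b w : shuffled col a b -> a < x < b -> a < w < b -> coshuffled x w.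
  by exists a, b.
split=> [u v xu xv uv|u xu|u xu|]; last by exists y.
- have [a [b [sh xab /andP[au ub] /andP[av vb] yab]]] := coshuffled_interval xu xv xy.
  have [w /andP[uw wv] eq_w] := sh u v y (ltW au) uv (ltW vb) yab.
  have xw : coshuffled x w.
    by apply: (inside a b) => //; rewrite (lt_trans au uw) (lt_trans wv vb).
  by exists w; [split=> //; apply: p_col py | rewrite uw wv].
- have [a [b [sh xab /andP[au ub] _ yab]]] := coshuffled_interval xu xu xy.
  have [w /andP[uw wb] eq_w] := sh u b y (ltW au) ub (lexx _) yab.
  have xw : coshuffled x w.
    by apply: (inside a b) => //; rewrite (lt_trans au uw) wb.
  by exists w => //; split=> //; apply: p_col py.
- have [a [b [sh xab /andP[au ub] _ yab]]] := coshuffled_interval xu xu xy.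
  have [w /andP[aw wu] eq_w] := sh a u y (lexx _) au (ltW ub) yab.
  have xw : coshuffled x w.
    by apply: (inside a b) => //; rewrite (lt_trans wu ub) aw.
  by exists w => //; split=> //; apply: p_col py.
Qed.

Variable num : rat -> nat.
Hypothesis hnum : dense_partition num.
Hypothesis Q_countable : countable [set: Q].

Lemma partition_dense n (D : rat -> Prop) : (0 < n)%N ->
  dense_in D (fun q => num q = n).
Proof.
have [_ num_nat dense] := hnum; move=> n0.
have lt1 (u : rat) : (u < u + 1)%R by rewrite ltrDl.
split=> [u v _ _ uv|u _|u _|].
- by have [q [nq uq qv]] := dense n n0 u v uv; exists q; rewrite ?uq.
- by have [q [nq uq _]] := dense n n0 u _ (lt1 u); exists q.
- have [|q [nq _ qu]] := dense n n0 (u - 1)%R u; last by exists q.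
  by have := lt1 (u - 1)%R; rewrite subrK.
- by exists n%:R%R; apply: num_nat.
Qed.

(** Skolem's extension of Cantor's theorem: countable dense orders without ends, split into equally
    many dense pieces, are isomorphic. The pieces are the positions here and the sets of the
    partition with index at most [m] there. *)
Lemma shuffle_coordinates x (pos : Q -> nat) m :
  coshuffled x x ->
  (forall y z, coshuffled x y -> coshuffled x z -> col y = col z -> pos y = pos z) ->
  (forall y, coshuffled x y -> (pos y < m)%N) ->
  (forall k, (k < m)%N -> exists2 y, coshuffled x y & pos y = k) ->
  exists g : Q -> rat,
    [/\ forall y z, coshuffled x y -> coshuffled x z -> y < z -> g y < g z,
        forall y, coshuffled x y -> num (g y) = (pos y).+1
      & forall q, (num q <= m)%N -> exists2 y, coshuffled x y & g y = q].
Proof.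
move=> xx pos_col pos_lt pos_onto; have [num_gt0 _ _] := hnum.
pose P (s : seq (Q * rat)) := partial_iso s /\ (forall p, p \in s ->
  [/\ coshuffled x p.1, (num p.2 <= m)%N & num p.2 = (pos p.1).+1]).
have [|||||f [fA f_mono f_surj fP _]] := @back_and_forth _ _ Q rat (coshuffled x)
  (fun q => (num q <= m)%N) P [::] Q_countable (countableP _) (inhabits 0%R).
- by split.
- by move=> s p [_ sP] /sP[].
- by move=> s p q [iso_s _]; apply: iso_s.
- move=> s y [iso_s sP] xy.
  have [||//|w wP iso_w] := @extend_partial_iso _ _ _ _ (fun=> True)
      (fun q => num q = (pos y).+1) s y; [exact: partition_dense|by []|].
  exists w; split=> // p; rewrite inE => /predU1P[->|]; last exact: sP.
  case: wP => [/sP//|nw]; rewrite /= nw; split=> //; exact: pos_lt.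
- move=> s q [iso_s sP] lenq.
  (* The back step extends the map with its pairs swapped; the predecessor appears because positions
     count from 0 and [num] from 1. *)
  have [|||y yP iso_y] := @extend_partial_iso _ _ rat Q (coshuffled x)
      (fun y => coshuffled x y /\ pos y = (num q).-1) [seq (p.2, p.1) | p <- s] q.
  + apply: coshuffled_dense => [y z xy xz eq_col <-|].
      exact: pos_col.
    by apply: pos_onto; rewrite prednK ?num_gt0.
  + by move=> r /mapP[p /sP[xp _ _] ->].
  + by move=> r r' /mapP[p ps ->] /mapP[p' p's ->]; rewrite /= iso_s.
  have memE (p : Q * rat) : ((p.2, p.1) \in [seq (p.2, p.1) | p <- s]) = (p \in s).
    apply/mapP/idP => [[p' p's]|]; last by exists p.
    by case: p p' p's => [? ?] [? ?] p's [-> ->].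
  exists y; split=> [p p'|p]; rewrite inE.
    have swap (r : Q * rat) : (r == (y, q)) || (r \in s) ->
        (r.2, r.1) \in (q, y) :: [seq (p.2, p.1) | p <- s].
      by rewrite inE memE => /predU1P[->|->]; rewrite ?eqxx ?orbT.
    by move=> /swap/iso_y iso1; rewrite inE => /swap/iso1 /= ->.
  move=> /predU1P[->|]; last exact: sP.
  case: yP => [|[xy posy]]; first by rewrite (memE (y, q)) => /sP.
  by split=> //=; rewrite posy prednK ?num_gt0.
exists f; split.
- by move=> y z xy xz yz; rewrite f_mono.
- by move=> y xy; have [s [_ sP] /sP[]] := fP y xy.
- by move=> q /f_surj.
Qed.

(** A sum node admits only the integer of each set of the partition, so a finite class uses position
    plus one, while a shuffle class uses the dense coordinates. Automorphisms preserve [num (g x)]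
    but need not preserve [g x]. *)
Lemma condensation_coordinates :
  exists (ch : Q -> seq tree) (g : Q -> rat),
    [/\ forall x, onth (ch x) (num (g x)).-1 = Some (col x),
        forall x y, condensed x y -> ch x = ch y,
        (forall f x, colour_automorphism col f ->
           ch (f x) = ch x /\ num (g (f x)) = num (g x)),
        (forall x y, condensed x y -> x < y -> g x < g y)
      & (forall x, ~ coshuffled x x -> g x = (num (g x))%:R%R) /\
        (forall x q, (num q <= size (ch x))%N ->
           (~ coshuffled x x -> q = (num q)%:R%R) ->
           exists2 y, condensed x y & g y = q)].
Proof.
have [num_gt0 num_nat _] := hnum.
have [ch [pos [ch_pos ch_eq auto_inv shufP sumP]]] := condensation_colour.
have [rep [repP rep_eq]] := representatives.
have /choice [G GP] : forall x, exists g : Q -> rat, coshuffled x x ->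
    [/\ forall y z, coshuffled x y -> coshuffled x z -> y < z -> g y < g z,
        forall y, coshuffled x y -> num (g y) = (pos y).+1
      & forall q, (num q <= size (ch x))%N -> exists2 y, coshuffled x y & g y = q].
  move=> x; have [xx|nxx] := pselect (coshuffled x x); last by exists (fun=> 0%R).
  have [posE pos_onto] := shufP x xx.
  have [||g gP] := @shuffle_coordinates x pos (size (ch x)) xx _ _ pos_onto.
  - by move=> y z xy xz eq_col; rewrite !posE // eq_col.
  - move=> y xy; rewrite (ch_eq x y (or_intror xy)) -onthTE.
    by rewrite ch_pos.
  by exists g.
(* Taking the map chosen at [rep x] gives all points of a class the same map. *)
pose g x := if `[< coshuffled x x >] then G (rep x) x else (pos x).+1%:R%R.
have rep_sh x : coshuffled x x -> coshuffled (rep x) x.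
  by move=> xx; apply/coshuffled_sym/condensed_coshuffled.
have sh_class x y : condensed x y -> coshuffled x x -> coshuffled y y.
  move=> xy xx; apply/coshuffled_id/coshuffled_sym.
  exact: condensed_coshuffled xx xy.
have num_g x : num (g x) = (pos x).+1.
  rewrite /g; case: asboolP => [xx|_]; last exact: num_nat.
  have rx := rep_sh x xx.
  by have [_ ->] := GP (rep x) (coshuffled_id rx).
exists ch, g; split=> //.
- by move=> x; rewrite num_g ch_pos.
- by move=> f x f_auto; rewrite !num_g; have [-> ->] := auto_inv f x f_auto.
- move=> x y xy lt_xy; rewrite /g; case: asboolP => xx; case: asboolP => yy.
  + rewrite -(rep_eq x y xy); have rx := rep_sh x xx.
    have [-> //] := GP (rep x) (coshuffled_id rx).
    by rewrite (rep_eq x y xy); apply: rep_sh.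
  + by case: yy; apply: sh_class xx.
  + by case: xx; apply: sh_class yy; apply: condensed_sym.
  + rewrite ltr_nat ltnS; have [mono _] := sumP x xx.
    by apply: mono => //; apply: condensed_near xy.
- split=> [x nxx|x q leq qE]; first by rewrite num_g /g; case: asboolP.
  have [xx|nxx] := pselect (coshuffled x x).
    have rx := rep_sh x xx; have [_ _ onto] := GP (rep x) (coshuffled_id rx).
    rewrite (ch_eq _ _ (repP x)) in leq; have [y ry gy] := onto q leq.
    have xy : coshuffled x y := coshuffled_trans (coshuffled_sym rx) ry.
    exists y; first by right.
    have yy := coshuffled_id (coshuffled_sym xy).
    by rewrite /g asboolT // -(rep_eq x y (or_intror xy)).
  have [_ onto] := sumP x nxx; have [|y xy posy] := onto (num q).-1.
    by rewrite prednK ?num_gt0.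
  exists y; first by left.
  rewrite /g; case: asboolP => [yy|_].
    by case: nxx; apply: sh_class yy; left; apply: near_sym.
  by rewrite posy prednK ?num_gt0 // -qE.
Qed.

End CondensationStep.

(** * Addresses in trees *)

Fixpoint subtree (T : tree) (u : seq nat) : option tree :=
  match u with
  | [::] => Some T
  | 0 :: _ => None
  | i.+1 :: v => if onth (children T) i is Some Ti then subtree Ti v else None
  end.

Lemma node_labelE T u : node_label T u = omap root_label (subtree T u).
Proof. by elim: u T => // -[|i] u IHu T //=; case: onth. Qed.

Lemma subtree_cat T u v :
  subtree T (u ++ v) = if subtree T u is Some T' then subtree T' v else None.
Proof. by elim: u T => // -[|i] u IHu T //=; case: onth. Qed.

Lemma subtree_rcons T u i : (0 < i)%N ->
  subtree T (rcons u i) =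
  if subtree T u is Some T' then onth (children T') i.-1 else None.
Proof.
case: i => // i _; rewrite -cats1 subtree_cat; case: subtree => //= T'.
by case: onth.
Qed.

Lemma subtree_TLeaf u : isSome (subtree TLeaf u) -> u = [::].
Proof. by case: u => // -[|i] u //=; rewrite onth0n. Qed.

Lemma ltxi_rcons (u v : seqlexi rat) (a b : rat) : size u = size v ->
  (rcons u a < rcons v b :> seqlexi rat) = (u < v) || ((u == v) && (a < b)).
Proof.
elim: u v => [|x u IHu] [|y v] //=.
  by rewrite ltxi_cons !ltxx /= implybF -ltNge andb_idl // => /ltW.
move=> [szuv]; rewrite !ltxi_cons IHu // eqseq_cons.
by case: (ltgtP x y) => //= _; case: (u < v).
Qed.

(** * Coloured orders as levels of tree unfoldings *)

Section Representation.
Variable num : rat -> nat.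
Hypothesis hnum : dense_partition num.

Definition valid (T : tree) (u : seq rat) : Prop :=
  forall i, (i < size u)%N -> is_sum T (take i (map num u)) ->
    nth 0%R u i = (num (nth 0%R u i))%:R%R.

Lemma valid_rcons T u q :
  valid T (rcons u q) <->
  valid T u /\ (is_sum T (map num u) -> q = (num q)%:R%R).
Proof.
have take_rcons i : (i <= size u)%N ->
    take i (map num (rcons u q)) = take i (map num u).
  by move=> lei; rewrite -!map_take -cats1 takel_cat.
split=> [val|[val qE] i].
  split=> [i lti|sum_u].
    have := val i; rewrite size_rcons ltnS take_rcons ?(ltnW lti) //.
    by rewrite nth_rcons lti; apply.
  have := val (size u); rewrite size_rcons take_rcons // nth_rcons ltnn eqxx.
  by rewrite -(size_map num) take_size; apply.
rewrite size_rcons ltnS leq_eqVlt => /predU1P[->|lti].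
  rewrite take_rcons // nth_rcons ltnn eqxx -(size_map num) take_size.
  exact: qE.
by rewrite take_rcons ?(ltnW lti) // nth_rcons lti; apply: val.
Qed.

Lemma valid_take T u n : valid T u -> valid T (take n u).
Proof.
move=> val i; rewrite size_take_min ltn_min => /andP[ltin ltiu].
by rewrite nth_take // map_take take_takel ?(ltnW ltin) //; apply: val.
Qed.

Lemma in_orderP T r : in_order num T r <-> is_leaf T (map num r) /\ valid T r.
Proof.
rewrite /in_order; split=> [/andP[-> /forallP sumP]|[-> val]].
  split=> // i lti sum_i; have := sumP (Ordinal lti).
  by rewrite /= sum_i => /eqP.
by apply/forallP => i; apply/implyP => sum_i; rewrite -(val i).
Qed.

(* [phi] identifies the coloured order with the nodes at depth [n] of the tree
   unfolding of [T], the colour of a point being the subtree hanging below. *)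
Definition represented (d : Order.disp_t) (Q : orderType d) (col : Q -> tree)
    : Prop :=
  exists (T : tree) (n : nat) (phi : Q -> seq rat),
    [/\ forall x y, (phi x < phi y :> seqlexi rat) = (x < y),
        forall x, [/\ size (phi x) = n, valid T (phi x)
                    & subtree T (map num (phi x)) = Some (col x)],
        forall u, size u = n -> valid T u -> isSome (subtree T (map num u)) ->
          exists x, phi x = u,
        forall u, valid T u -> is_leaf T (map num u) -> (n <= size u)%N
      & forall f, colour_automorphism col f ->
          (forall x, map num (phi (f x)) = map num (phi x)) /\
          (forall j x y, take j (phi x) = take j (phi y) ->
             take j (phi (f x)) = take j (phi (f y)))].

End Representation.

Record suborder (d : Order.disp_t) (Q : orderType d) (P : pred Q) :=
  Suborder { suborder_val : Q; _ : P suborder_val }.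

HB.instance Definition _ (d : Order.disp_t) (Q : orderType d) (P : pred Q) :=
  [isSub for @suborder_val d Q P].
HB.instance Definition _ (d : Order.disp_t) (Q : orderType d) (P : pred Q) :=
  [Choice of suborder P by <:].
HB.instance Definition _ (d : Order.disp_t) (Q : orderType d) (P : pred Q) :=
  [SubChoice_isSubOrder of suborder P by <: with d].

Section Induction.
Variable num : rat -> nat.
Hypothesis hnum : dense_partition num.

(** The leaf is only a default: the lists of children of classes are nonempty. *)
Definition node (shuffle : bool) (s : seq tree) : tree :=
  if s is t :: s' then (if shuffle then TShuffle t s' else TSum t s') else TLeaf.

Lemma children_node b s : children (node b s) = s.
Proof. by case: s => // t s; case: b. Qed.

(** The induction hypothesis makes each class a node at depth [n] whose subtree is the sum or
    shuffle of its colours; the coordinate within the class then selects a child. *)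
Lemma orbits_represented N (d : Order.disp_t) (Q : orderType d) (col : Q -> tree) :
  countable [set: Q] -> inhabited Q -> pair_orbits_le col N ->
  represented num col.
Proof.
elim: N d Q col => [|N IHN] d Q col Q_countable [x0] orbits.
  by have [c [s [+ /(_ x0 x0)]]] := orbits; rewrite leqn0 => /nilP ->.
have [[a0 [b0 ab0]]|single] := pselect (exists a b : Q, a < b); last first.
  have eqx0 x : x = x0.
    by apply/eqP; case: ltgtP => // lt_x; case: single; [exists x, x0|exists x0, x].
  exists (col x0), 0, (fun=> [::]); split=> //.
  - by move=> x y; rewrite (eqx0 x) (eqx0 y) !ltxx.
  - by move=> x; rewrite (eqx0 x).
  - by move=> u /size0nil ->; exists x0.
have [rep [repP rep_eq]] := representatives col.
have [ch [g [ch_g ch_eq auto_inv g_mono [g_sum g_onto]]]] :=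
  condensation_coordinates orbits hnum Q_countable.
have num_gt0 : forall q, (0 < num q)%N by case: hnum.
have rep_id x : rep (rep x) = rep x by rewrite -(rep_eq x (rep x)).
pose Q' := suborder (fun x => rep x == x).
have class_subproof x : rep (rep x) == rep x by rewrite rep_id.
pose cls x : Q' := @Suborder d Q (fun x => rep x == x) _ (class_subproof x).
have clsK (z : Q') : cls (val z) = z by apply/val_inj/eqP/(valP z).
have cls_eq x y : condensed col x y -> cls x = cls y.
  by move=> xy; apply/val_inj/rep_eq.
have cls_inj x y : cls x = cls y -> condensed col x y.
  move=> [eq_rep]; apply: condensed_trans (repP x) _; rewrite eq_rep.
  exact/condensed_sym.
have cls_lt x y : x < y -> ~ condensed col x y -> cls x < cls y.
  by move=> xy nxy; apply: condensed_mono (repP x) (repP y) nxy xy.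
pose colQ (z : Q') := node `[< coshuffled col (val z) (val z) >] (ch (val z)).
have ch_neq0 x : ch x != [::].
  by apply/eqP => ch0; have := ch_g x; rewrite ch0 onth0n.
have labelQ z : root_label (colQ z) =
    if `[< coshuffled col (val z) (val z) >] then LShuffle else LSum.
  by rewrite /colQ; have := ch_neq0 (val z); case: (ch _) => // t s; case: asbool.
(* Automorphisms need not send representatives to representatives, so the image is replaced by the
   representative of its class. *)
pose lift (f : Q -> Q) (z : Q') := cls (f (val z)).
have lift_cls f x : colour_automorphism col f -> lift f (cls x) = cls (f x).
  move=> f_auto; apply: cls_eq; apply: condensed_automorphism f_auto _ _ _.
  exact/condensed_sym.
have lift_mono f : colour_automorphism col f -> {homo lift f : z z' / z < z'}.
  move=> f_auto z z' zz'; apply: cls_lt; first by rewrite f_auto.1.2.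
  have [h [h_auto fK _]] := colour_automorphism_inv f_auto.
  move=> /(condensed_automorphism h_auto); rewrite !fK => /cls_eq.
  by rewrite !clsK => eq_z; move: zz'; rewrite eq_z ltxx.
have lift_auto f : colour_automorphism col f -> colour_automorphism colQ (lift f).
  move=> f_auto; have [h [h_auto fK hK]] := colour_automorphism_inv f_auto.
  have liftK f1 f2 : colour_automorphism col f1 -> colour_automorphism col f2 ->
      cancel f1 f2 -> cancel (lift f1) (lift f2).
    by move=> a1 a2 f12 z; rewrite [lift f1 z]/lift lift_cls // f12 clsK.
  split; first split.
  - by exists (lift h); apply: liftK.
  - move=> z z'; apply/idP/idP; last exact: lift_mono.
    by move=> /(lift_mono h h_auto); rewrite !(liftK f h).
  move=> z; rewrite /colQ /lift /=.
  have fz : condensed col (f (val z)) (rep (f (val z))) := repP _.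
  rewrite -(ch_eq _ _ fz) (auto_inv f (val z) f_auto).1; congr node.
  apply: asbool_equiv_eq; split=> [rr|zz].
    apply/(coshuffled_automorphismE _ _ f_auto).
    apply/coshuffled_id/coshuffled_sym/(condensed_coshuffled rr).
    exact: condensed_sym.
  apply: coshuffled_id; apply: coshuffled_sym; apply: condensed_coshuffled fz.
  exact/(coshuffled_automorphismE _ _ f_auto).
have orbitsQ : pair_orbits_le colQ N.
  have [x [y [neq_xy xy]]] := condensed_nontrivial orbits ab0.
  have [c [s [sz_s cs c_orb]]] := orbits.
  exists (fun z z' => c (val z) (val z')), (rem (c x y) s); split.
  - by rewrite size_rem // -ltnS prednK //; case: (s) (cs x y).
  - move=> z z'; apply: contraT => nzz'; case: notF.
    have eq_c : c x y = c (val z) (val z').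
      apply/eqP; apply: contraNT nzz' => neq_c.
      by have := perm_to_rem (cs x y) => /perm_mem/(_ (c (val z) (val z')));
        rewrite cs inE eq_sym (negbTE neq_c) /= => <-.
    have [f [f_auto fx fy]] := c_orb _ _ _ _ eq_c.
    case: neq_xy; apply: (bij_inj f_auto.1.1); rewrite fx fy; congr val.
    rewrite -(clsK z) -(clsK z') -fx -fy; apply: cls_eq.
    exact: condensed_automorphism.
  - move=> z1 z2 z1' z2' /c_orb[f [f_auto fz1 fz2]]; exists (lift f).
    by rewrite /lift fz1 fz2 !clsK; split=> //; apply: lift_auto.
have countQ : countable [set: Q'].
  have [h h_inj] := countable_injection Q_countable.
  by apply/countable_injP; exists (h \o val) => z z' _ _ /h_inj/val_inj.
have [T [n [phi [phi_mono phiP phi_onto phi_leaf phi_auto]]]] :=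
  IHN d Q' colQ countQ (inhabits (cls x0)) orbitsQ.
have sumE z : is_sum T (map num (phi z)) = ~~ `[< coshuffled col (val z) (val z) >].
  have [_ _ subT] := phiP z; rewrite /is_sum node_labelE subT /= labelQ.
  by case: asbool.
pose psi x := rcons (phi (cls x)) (g x).
have sz_phi z : size (phi z) = n by have [] := phiP z.
have psi_lt x y : x < y -> psi x < psi y :> seqlexi rat.
  move=> xy; rewrite ltxi_rcons ?sz_phi // phi_mono.
  have [cxy|ncxy] := pselect (condensed col x y); last by rewrite cls_lt.
  by rewrite (cls_eq x y cxy) eqxx g_mono ?orbT.
exists T, n.+1, psi; split.
- move=> x y; case: (ltgtP x y) => [/psi_lt -> //|yx|->]; last exact: ltxx.
  by apply/negbTE; rewrite -leNgt ltW // psi_lt.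
- move=> x; have [szx valx subx] := phiP (cls x); split.
  + by rewrite size_rcons szx.
  + apply/valid_rcons; split=> //; rewrite sumE => /asboolPn nsh.
    apply: g_sum => xx; apply: nsh => /=.
    exact/coshuffled_id/coshuffled_sym/(condensed_coshuffled xx).
  + by rewrite map_rcons subtree_rcons // subx children_node -(ch_eq _ _ (repP x)).
- move=> u; case/lastP: u => [|v q]; rewrite ?size_rcons // => -[szv].
  move=> /valid_rcons[valv qE]; rewrite map_rcons subtree_rcons //.
  case subv: subtree => [T'|] //; have [|z phiz] := phi_onto v szv valv.
    by rewrite subv.
  have [_ _] := phiP z; rewrite phiz subv => -[->].
  rewrite children_node onthTE prednK // => leq.
  have [|y zy gy] := g_onto (val z) q leq.
    by move=> nsh; apply: qE; rewrite -phiz sumE; apply/asboolPn.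
  by exists y; rewrite /psi -(cls_eq _ _ zy) clsK phiz gy.
(* A node at depth [n] is a class, labelled sum or shuffle, so a leaf lies strictly deeper. *)
- move=> u valu leafu; have := phi_leaf u valu leafu; rewrite leq_eqVlt.
  case/predU1P => // szu; have [|z phiz] := phi_onto u (esym szu) valu.
    by move: leafu; rewrite /is_leaf node_labelE; case: subtree.
  move: leafu; rewrite /is_leaf node_labelE -phiz; have [_ _ ->] := phiP z.
  by rewrite /= labelQ; case: asbool.
- move=> f f_auto; have [lift_num lift_take] := phi_auto _ (lift_auto f f_auto).
  have num_f x : map num (psi (f x)) = map num (psi x).
    by rewrite !map_rcons -lift_cls // lift_num (auto_inv f x f_auto).2.
  split=> // j x y; have [lejn|ltnj] := leqP j n.
    rewrite /psi -!cats1 !takel_cat ?sz_phi // => /lift_take.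
    by rewrite !lift_cls.
  rewrite !take_oversize ?size_rcons ?sz_phi // => eq_psi.
  suff -> : x = y by [].
  by apply/eqP; case: ltgtP => // /psi_lt; rewrite eq_psi ltxx.
Qed.

End Induction.

Theorem theorem9 (num : rat -> nat) (hnum : dense_partition num)
    (d : Order.disp_t) (L : orderType d) (L_nonempty : inhabited L)
    (hL : countably_categorical L) :
  exists T : tree, isomorphic L (tree_order num T) /\ canonical num T.
Proof.
have [c [s [cs c_orb]]] := finitely_many_pair_orbits L_nonempty hL.
(* With a single colour every order automorphism preserves colours. *)
have orbits : pair_orbits_le (fun _ : L => TLeaf) (size s).
  by exists c, s; split=> // x y x' y' /c_orb[f [f_iso fx fy]]; exists f; do 2?split.
have [T [n [phi [phi_mono phiP phi_onto phi_leaf phi_auto]]]] :=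
  orbits_represented hnum hL.1 L_nonempty orbits.
have phi_in x : in_order num T (phi x).
  have [_ valx subx] := phiP x; apply/in_orderP; split=> //.
  by rewrite /is_leaf node_labelE subx.
pose F x : tree_order num T := TreeOrder (phi_in x).
have F_mono : {mono F : x y / x < y} by move=> x y; apply: phi_mono.
have F_inj : injective F.
  by move=> x y eq_F; apply/eqP; case: ltgtP => //; rewrite -F_mono eq_F ltxx.
have F_onto r : exists x, F x = r.
  have /in_orderP[leafr valr] := valP r.
  (* The prefix of length [n] already carries the subtree [TLeaf], so the sequence ends there. *)
  have szr := phi_leaf _ valr leafr; set u := tree_order_val r in leafr valr szr.
  have nodeu : isSome (subtree T (map num u)).
    by move: leafr; rewrite /is_leaf node_labelE; case: subtree.
  move: nodeu; rewrite -{1}(cat_take_drop n u) map_cat subtree_cat.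
  case subT: subtree => [T'|] // nodeT'.
  have [|||x phix] := phi_onto (take n u).
  - by rewrite size_takel.
  - exact: valid_take.
  - by rewrite subT.
  exists x; apply: val_inj; rewrite /= phix -[RHS](cat_take_drop n u).
  have [_ _] := phiP x; rewrite phix subT => -[T'E].
  have := subtree_TLeaf; rewrite -T'E => /(_ _ nodeT') /(congr1 size).
  by rewrite size_map => /size0nil ->; rewrite cats0.
have /choice [G GK] := F_onto.
have FK : cancel F G by move=> x; apply: F_inj; rewrite GK.
exists T; split; first by exists F; split=> //; exists G.
move=> h h_iso; split=> // t _.
have conj_iso k : order_iso k ->
    colour_automorphism (fun _ : L => TLeaf) (G \o k \o F).
  move=> [[k' kK k'K] k_mono]; split=> //; split.
    by exists (G \o k' \o F) => x; rewrite /= GK ?kK ?k'K FK.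
  by move=> x y; rewrite /= -F_mono !GK k_mono F_mono.
have [num_h take_h] := phi_auto _ (conj_iso h h_iso).
(* Preservation of common prefixes is only an implication; the inverse of [h] supplies the
   converse. *)
have [[h' hK h'K] h_mono] := h_iso.
have h'_iso : order_iso h'.
  by split; [exists h | move=> x y; rewrite -h_mono !h'K].
have [_ take_h'] := phi_auto _ (conj_iso h' h'_iso).
move=> r r'; have [x <-] := F_onto r; have [y <-] := F_onto r'.
have hF z : h (F z) = F ((G \o h \o F) z) by rewrite /= GK.
rewrite /rel_E /in_D !hF; congr [&& _, _ & _].
- by rewrite [tree_order_val _]/= num_h.
- by rewrite [tree_order_val _]/= num_h.
- apply/eqP/eqP => /= eq_take; last exact: take_h.
  by have := take_h' _ _ _ eq_take; rewrite /= !GK !hK !FK.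
Qed.
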